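(* The twisted Hilbert space $Z(\mathcal S^2)$ contains an isomorphic copy of $Z_2$.
   Context: All Banach spaces are complex; isomorphic means linearly homeomorphic. **Derived spaces.** Let $\omega$ be the space of all complex sequences with coordinatewise convergence and $(e_j)$ the unit vectors. Let $X$ be a Banach sequence space and let its dual $X^*$ be regarded as a sequence space through the bilinear pairing $\langle x,y\rangle=\sum_j x_jy_j$; assume $(e_j)$ is an unconditional basis of both $X$ and $X^*$. Let $\mathbb S=\{z\in\mathbb C:0\le \mathrm{Re}\, z\le 1\}$. $\mathcal F_\infty(X,X^* )$ is the space of functions $F:\mathbb S\to\omega$ that are bounded and continuous on $\mathbb S$, analytic in the interior of $\mathbb S$, and such that $t\mapsto F(it)\in X$ and $t\mapsto F(1+it)\in X^*$ are bounded continuous functions, with norm $\|F\|=\max(\sup_t\|F(it)\|_X,\sup_t\|F(1+it)\|_{X^*})$. The interpolation space $(X,X^* )_{1/2}=\{F(1/2):F\in\mathcal F_\infty(X,X^* )\}$ carries the quotient norm. When $(X,X^* )_{1/2}=\ell_2$ (with equivalent norms), the derived space $Z(X)$ is the space of pairs $(x,y)\in\omega\times\omega$ for which $\|(x,y)\|_{Z(X)}=\inf\{\|F\|:F\in\mathcal F_\infty(X,X^* ),\ F(1/2)=y,\ F'(1/2)=x\}$ is finite; it is a twisted Hilbert space (it has a subspace isomorphic to $\ell_2$ with quotient isomorphic to $\ell_2$). **The space $\mathcal S^2$.** A finite set $A=\{n_1<\dots<n_k\}\subset\mathbb N$ is admissible if $k\le n_1$. $\mathcal S^2$, the 2-convexification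 of the Schreier space, is the completion of the space $c_{00}$ of finitely supported sequences under $\|x\|_{\mathcal S^2}=\sup_A(\sum_{j\in A}|x_j|^2)^{1/2}$, the supremum over admissible $A$. One has $(\mathcal S^2,(\mathcal S^2)^* )_{1/2}=\ell_2$ with equivalent norms. **The Kalton-Peck space $Z_2$.** Let $\Omega:\ell_2\to\omega$ be the homogeneous map $\Omega(y)=\sum_jy_j\log(|y_j|/\|y\|_2)e_j$ (with $0\cdot\log0=0$ and $\Omega(0)=0$). $Z_2$ is the space of pairs $(x,y)\in\omega\times\ell_2$ with $x-\Omega(y)\in\ell_2$ with the quasi-norm $\|(x,y)\|=\|x-\Omega(y)\|_2+\|y\|_2$, which is equivalent to a Banach space norm. *)

(* Defs.v *)
(* Stdlib real numbers, with Coquelicot for complex numbers, limits, power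
   series and suprema. *)
From Stdlib Require Import Reals List FunctionalExtensionality.
From Coquelicot Require Import Coquelicot.
Open Scope R_scope.

(* [omega] is the space of all complex sequences.  Sequences are indexed by
   {1, 2, ...} on paper: [x j] is the coefficient of the (j+1)-st unit vector. *)
Definition omega : Type := nat -> C.

Section OmegaModule.
Let oplus (x y : omega) : omega := fun j => (x j + y j)%C.
Let ozero : omega := fun _ => RtoC 0.
Let oopp (x : omega) : omega := fun j => (- x j)%C.
Let oscal (a : C) (x : omega) : omega := fun j => (a * x j)%C.

Fact oplus_comm (x y : omega) : oplus x y = oplus y x.
Proof. apply functional_extensionality; intro j; apply Cplus_comm. Qed.
Fact oplus_assoc (x y z : omega) : oplus x (oplus y z) = oplus (oplus x y) z.
Proof. apply functional_extensionality; intro j; apply Cplus_assoc. Qed.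
Fact oplus_zero_r (x : omega) : oplus x ozero = x.
Proof. apply functional_extensionality; intro j; apply Cplus_0_r. Qed.
Fact oplus_opp_r (x : omega) : oplus x (oopp x) = ozero.
Proof. apply functional_extensionality; intro j; apply Cplus_opp_r. Qed.

Definition omega_AbelianMonoid_mixin :=
  AbelianMonoid.Mixin omega oplus ozero oplus_comm oplus_assoc oplus_zero_r.
Canonical omega_AbelianMonoid :=
  AbelianMonoid.Pack omega omega_AbelianMonoid_mixin omega.
Definition omega_AbelianGroup_mixin :=
  AbelianGroup.Mixin omega_AbelianMonoid oopp oplus_opp_r.
Canonical omega_AbelianGroup :=
  AbelianGroup.Pack omega
    (AbelianGroup.Class omega omega_AbelianMonoid_mixin
       omega_AbelianGroup_mixin) omega.

Fact oscal_assoc (a b : C) (x : omega) :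
  oscal a (oscal b x) = oscal (a * b)%C x.
Proof. apply functional_extensionality; intro j; apply Cmult_assoc. Qed.
Fact oscal_one (x : omega) : oscal (RtoC 1) x = x.
Proof. apply functional_extensionality; intro j; apply Cmult_1_l. Qed.
Fact oscal_distr_l (a : C) (x y : omega) :
  oscal a (oplus x y) = oplus (oscal a x) (oscal a y).
Proof. apply functional_extensionality; intro j; apply Cmult_plus_distr_l. Qed.
Fact oscal_distr_r (a b : C) (x : omega) :
  oscal (a + b)%C x = oplus (oscal a x) (oscal b x).
Proof. apply functional_extensionality; intro j; apply Cmult_plus_distr_r. Qed.

Definition omega_ModuleSpace_mixin :=
  ModuleSpace.Mixin C_Ring omega_AbelianGroup oscal
    oscal_assoc oscal_one oscal_distr_l oscal_distr_r.
Canonical omega_ModuleSpace :=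
  ModuleSpace.Pack C_Ring omega
    (ModuleSpace.Class C_Ring omega
       (AbelianGroup.class omega_AbelianGroup) omega_ModuleSpace_mixin) omega.
End OmegaModule.

Definition omega2 : ModuleSpace C_Ring :=
  prod_ModuleSpace C_Ring omega_ModuleSpace omega_ModuleSpace.

(* A (quasi-)normed space realized inside a complex vector space [V]: its
   underlying set and its (quasi-)norm.  The values of [nrm] outside [carrier]
   are irrelevant.  No axioms are imposed here: the concrete spaces below are
   linear subspaces and their [nrm] is a quasi-norm, but as facts. *)
Record nspace (V : ModuleSpace C_Ring) : Type := NSpace {
  carrier : V -> Prop;
  nrm : V -> R
}.
Arguments carrier {V} _ _.
Arguments nrm {V} _ _.

Definition restrict {V : ModuleSpace C_Ring} (E : nspace V) (W : V -> Prop) :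
  nspace V := NSpace V W (nrm E).

Definition linear_on {V W : ModuleSpace C_Ring} (E : nspace V) (T : V -> W) :
  Prop :=
  forall (a : C) (u v : V), carrier E u -> carrier E v ->
    T (plus (scal a u) v) = plus (scal a (T u)) (T v).

Definition continuous_map {V W : ModuleSpace C_Ring}
    (E : nspace V) (G : nspace W) (T : V -> W) : Prop :=
  forall u, carrier E u -> forall eps, 0 < eps -> exists delta, 0 < delta /\
    forall v, carrier E v ->
      nrm E (minus v u) < delta -> nrm G (minus (T v) (T u)) < eps.

Definition isomorphic {V W : ModuleSpace C_Ring} (E : nspace V) (G : nspace W) :
  Prop :=
  exists (T : V -> W) (T' : W -> V),
    linear_on E T /\
    (forall u, carrier E u -> carrier G (T u) /\ T' (T u) = u) /\
    (forall w, carrier G w -> carrier E (T' w) /\ T (T' w) = w) /\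
    continuous_map E G T /\
    continuous_map G E T'.

(* The subset [M], being a linear image of [E], is a linear subspace whenever
   [E] is one. *)
Definition contains_copy {V W : ModuleSpace C_Ring}
    (G : nspace W) (E : nspace V) : Prop :=
  exists M : W -> Prop,
    (forall w, M w -> carrier G w) /\ isomorphic E (restrict G M).

(* The dual of [X] for the bilinear pairing (no conjugation), with the operator
   norm. *)
Definition pairing (x y : omega) (l : C) : Prop :=
  is_series (K := C_AbsRing) (V := C_NormedModule) (fun j => (x j * y j)%C) l.

Definition dual (X : nspace omega_ModuleSpace) : nspace omega_ModuleSpace :=
  NSpace omega_ModuleSpace
    (fun y => exists M : R, forall x, carrier X x ->
       exists l, pairing x y l /\ Cmod l <= M * nrm X x)
    (fun y => real (Lub_Rbar (fun r => exists x l,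
       carrier X x /\ nrm X x <= 1 /\ pairing x y l /\ r = Cmod l))).

Definition strip (z : C) : Prop := 0 <= Re z <= 1.
Definition strip_interior (z : C) : Prop := 0 < Re z < 1.

Definition analytic_at (f : C -> C) (z0 : C) : Prop :=
  exists (a : nat -> C) (r : R), 0 < r /\
    forall z, Cmod (z - z0)%C < r ->
      is_pseries (K := C_AbsRing) (V := C_NormedModule) a (z - z0)%C (f z).

Definition bounded_continuous_into (E : nspace omega_ModuleSpace)
    (g : R -> omega) : Prop :=
  (forall t, carrier E (g t)) /\
  (exists M : R, forall t, nrm E (g t) <= M) /\
  (forall t, filterlim (fun s => nrm E (minus (g s) (g t)))
               (locally t) (locally 0)).

(* The space F_infty(X, Y).  As [omega] carries the topology of coordinatewise
   convergence, boundedness, continuity and analyticity of an [omega]-valued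
   function are those of its coordinates.  Only values on the strip matter. *)
Definition Finfty (X Y : nspace omega_ModuleSpace) (F : C -> omega) : Prop :=
  (forall j, exists M : R, forall z, strip z -> Cmod (F z j) <= M) /\
  (forall j z, strip z ->
     filterlim (fun w => F w j) (within strip (locally z)) (locally (F z j))) /\
  (forall j z, strip_interior z -> analytic_at (fun w => F w j) z) /\
  bounded_continuous_into X (fun t => F (0, t)) /\
  bounded_continuous_into Y (fun t => F (1, t)).

Definition Finfty_norm (X Y : nspace omega_ModuleSpace) (F : C -> omega) : R :=
  Rmax (real (Lub_Rbar (fun r => exists t : R, r = nrm X (F (0, t)))))
       (real (Lub_Rbar (fun r => exists t : R, r = nrm Y (F (1, t))))).

Definition derived_norm (X : nspace omega_ModuleSpace) (p : omega2) : Rbar :=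
  Glb_Rbar (fun r => exists F : C -> omega,
    Finfty X (dual X) F /\
    F (RtoC (1 / 2)) = snd p /\
    (forall j, is_derive (K := C_AbsRing) (V := C_NormedModule)
                 (fun z => F z j) (RtoC (1 / 2)) (fst p j)) /\
    r = Finfty_norm X (dual X) F).

(* The derived space Z(X); the infimum of the empty set is [p_infty]. *)
Definition derived (X : nspace omega_ModuleSpace) : nspace omega2 :=
  NSpace omega2 (fun p => is_finite (derived_norm X p))
                (fun p => real (derived_norm X p)).

(* A finite set of positive integers n is listed by its shifted elements
   j = n - 1, hence [S j] for the bound on the cardinality. *)
Definition admissible (A : list nat) : Prop :=
  NoDup A /\ forall j, In j A -> (length A <= S j)%nat.

Definition S2_norm (x : omega) : Rbar :=
  Lub_Rbar (fun r => exists A, admissible A /\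
    r = sqrt (fold_right Rplus 0 (map (fun j => (Cmod (x j)) ^ 2) A))).

Definition c00 (x : omega) : Prop :=
  exists N, forall j, (N <= j)%nat -> x j = RtoC 0.

(* The 2-convexified Schreier space.  The sequences with finite [S2_norm] form
   a Banach space under [S2_norm], and the completion of [c00] is realized as
   the closure of [c00] in it. *)
Definition S2 : nspace omega_ModuleSpace :=
  NSpace omega_ModuleSpace
    (fun x => forall eps : R, 0 < eps ->
       exists y, c00 y /\ Rbar_lt (S2_norm (minus x y)) eps)
    (fun x => real (S2_norm x)).

Definition ell2 (x : omega) : Prop := ex_series (fun j => (Cmod (x j)) ^ 2).
Definition ell2_norm (x : omega) : R :=
  sqrt (Series (fun j => (Cmod (x j)) ^ 2)).

(* No case distinction is needed at zero: if [y j] vanishes, so does the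
   product, whatever the value of [ln]. *)
Definition Omega (y : omega) : omega :=
  fun j => (y j * RtoC (ln (Cmod (y j) / ell2_norm y)))%C.

(* The Kalton-Peck space. *)
Definition Z2 : nspace omega2 :=
  NSpace omega2
    (fun p => ell2 (snd p) /\ ell2 (minus (fst p) (Omega (snd p))))
    (fun p => ell2_norm (minus (fst p) (Omega (snd p))) + ell2_norm (snd p)).

(* Main.v *)
From Stdlib Require Import Reals List Lra Lia.
From Stdlib Require Import FunctionalExtensionality ClassicalEpsilon.
From Coquelicot Require Import Coquelicot.
Require Import Defs.

(** The normalized indicators [u_k] of the dyadic blocks [2^k <= n < 2^(k+1)]
    span a copy of [c_0] in S^2, because an admissible set meeting the [k]-th
    block has fewer than [2^(k+1)] elements.  Each block is itself admissible,
    so that by the Cauchy-Schwarz inequality the block averages are bounded on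
    S^2, and the same vectors span a copy of [l_1] in the dual.  Spreading a
    sequence over the blocks and averaging over them thus identify the
    block-constant part of the couple formed by S^2 and its dual with the couple
    [(c_0, l_1)], and it remains to see that the derived space of the latter is
    [Z2].  The classical reason is that [y_k (|y_k| / |y|)^(2z - 1)] is an
    almost optimal extension of [y], with derivative [2 Omega y] at [1/2].  So
    the copy of [Z2] consists of the pairs [embed (x, y)], built from
    [sum_k 2 x_k u_k] and [sum_k y_k u_k].

    Lower bound.  An extension [F] of [embed (x, y)] has block averages [f_k]
    bounded by [M] on [Re z = 0], with [sum_k |f_k| <= M] on [Re z = 1]
    ([average_bounded]).  The three lines argument [half_l2_bound] gives
    [|y|_2 <= M].  Subtracting the extremal function leaves a function that
    vanishes at [1/2]; divided by [z - 1/2] it is still bounded on the boundary,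
    and the same argument bounds its value at [1/2], which is
    [2 (x - Omega y)] ([half_derivative_bound]).  The complex analysis needed
    is a maximum principle on the strip; it is proved from second-order Taylor
    expansions alone, by averaging over four points ([four_point_mean]), without
    contour integrals.

    Upper bound.  The extremal function is not admitted as it stands, because on
    [Re z = 0] its moduli are constant instead of tending to zero.  A slowly
    vanishing weight repairs this at the price of an error in [l_2]
    ([slow_weight], [extremal_function]), and an error in [l_2] is corrected by
    adding [exp (z - 1/2) - 1] times a second extremal function
    ([Z2_extension]).

    Together the bounds say that the norms of [p] and [embed p] are equivalent.
    They also show that [Z2] is closed under subtraction ([Z2_minus]), which
    turns the equivalence of norms into continuity in both directions. *)

(** * Finite sums over lists *)

Definition lsum (f : nat -> R) (l : list nat) : R :=
  fold_right Rplus 0 (map f l).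

Definition csum (f : nat -> C) (l : list nat) : C :=
  fold_right Cplus (RtoC 0) (map f l).

Lemma lsum_cons f k l : lsum f (k :: l) = f k + lsum f l.
Proof. reflexivity. Qed.

Lemma csum_cons f k l : csum f (k :: l) = (f k + csum f l)%C.
Proof. reflexivity. Qed.

Lemma lsum_app f l l' : lsum f (l ++ l') = lsum f l + lsum f l'.
Proof.
  induction l as [|k l IH]; simpl app.
  - unfold lsum at 2; simpl; ring.
  - rewrite !lsum_cons, IH; ring.
Qed.

Lemma csum_app f l l' : csum f (l ++ l') = (csum f l + csum f l')%C.
Proof.
  induction l as [|k l IH]; simpl app.
  - unfold csum at 2; simpl; ring.
  - rewrite !csum_cons, IH; ring.
Qed.

Lemma lsum_seq_S f n : lsum f (seq 0 (S n)) = lsum f (seq 0 n) + f n.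
Proof.
  rewrite seq_S, lsum_app; f_equal; unfold lsum; simpl; ring.
Qed.

Lemma lsum_ext f g l : (forall k, In k l -> f k = g k) -> lsum f l = lsum g l.
Proof.
  intro H; unfold lsum; rewrite (map_ext_in f g l H); reflexivity.
Qed.

Lemma csum_ext f g l : (forall k, In k l -> f k = g k) -> csum f l = csum g l.
Proof.
  intro H; unfold csum; rewrite (map_ext_in f g l H); reflexivity.
Qed.

Lemma lsum_le f g l :
  (forall k, In k l -> f k <= g k) -> lsum f l <= lsum g l.
Proof.
  induction l as [|k l IH]; intro H; [apply Rle_refl|].
  rewrite !lsum_cons.
  apply Rplus_le_compat; [apply H; left; reflexivity|].
  apply IH; intros; apply H; right; assumption.
Qed.

Lemma lsum_const c l : lsum (fun _ => c) l = INR (length l) * c.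
Proof.
  induction l as [|k l IH]; [unfold lsum; simpl; ring|].
  rewrite lsum_cons, IH; simpl length; rewrite S_INR; ring.
Qed.

Lemma lsum_nonneg f l : (forall k, In k l -> 0 <= f k) -> 0 <= lsum f l.
Proof.
  intro H.
  replace 0 with (lsum (fun _ => 0) l) by (rewrite lsum_const; ring).
  apply lsum_le, H.
Qed.

Lemma lsum_plus f g l : lsum (fun k => f k + g k) l = lsum f l + lsum g l.
Proof.
  induction l as [|k l IH]; [unfold lsum; simpl; ring|].
  rewrite !lsum_cons, IH; ring.
Qed.

Lemma lsum_scal c f l : lsum (fun k => c * f k) l = c * lsum f l.
Proof.
  induction l as [|k l IH]; [unfold lsum; simpl; ring|].
  rewrite !lsum_cons, IH; ring.
Qed.

Lemma csum_scal c f l : csum (fun k => c * f k)%C l = (c * csum f l)%C.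
Proof.
  induction l as [|k l IH]; [unfold csum; simpl; ring|].
  rewrite !csum_cons, IH; ring.
Qed.

Lemma csum_const c l : csum (fun _ => c) l = (RtoC (INR (length l)) * c)%C.
Proof.
  induction l as [|k l IH]; [unfold csum; simpl; ring|].
  rewrite csum_cons, IH; simpl length; rewrite S_INR, RtoC_plus; ring.
Qed.

Lemma csum_RtoC f l : csum (fun k => RtoC (f k)) l = RtoC (lsum f l).
Proof.
  induction l as [|k l IH]; [reflexivity|].
  rewrite csum_cons, lsum_cons, IH, RtoC_plus; reflexivity.
Qed.

Lemma csum_Cmod f l : Cmod (csum f l) <= lsum (fun k => Cmod (f k)) l.
Proof.
  induction l as [|k l IH].
  - unfold csum, lsum; simpl; rewrite Cmod_0; lra.
  - rewrite csum_cons, lsum_cons.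
    eapply Rle_trans; [apply Cmod_triangle|]; lra.
Qed.

Lemma lsum_in f l k :
  (forall i, In i l -> 0 <= f i) -> In k l -> f k <= lsum f l.
Proof.
  induction l as [|i l IH]; intros Hf Hk; [destruct Hk|].
  rewrite lsum_cons; destruct Hk as [->|Hk].
  - assert (0 <= lsum f l)
      by (apply lsum_nonneg; intros; apply Hf; right; assumption); lra.
  - assert (f k <= lsum f l)
      by (apply IH; [intros; apply Hf; right|]; assumption).
    assert (0 <= f i) by (apply Hf; left; reflexivity); lra.
Qed.

Lemma lsum_Cauchy_Schwarz f g l :
  (lsum (fun k => f k * g k) l) ^ 2
  <= lsum (fun k => f k ^ 2) l * lsum (fun k => g k ^ 2) l.
Proof.
  induction l as [|k l IH]; [unfold lsum; simpl; lra|].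
  rewrite !lsum_cons.
  assert (Hf : 0 <= lsum (fun k => f k ^ 2) l)
    by (apply lsum_nonneg; intros; apply pow2_ge_0).
  assert (Hg : 0 <= lsum (fun k => g k ^ 2) l)
    by (apply lsum_nonneg; intros; apply pow2_ge_0).
  set (p := lsum (fun k => f k * g k) l) in *.
  set (P := lsum (fun k => f k ^ 2) l) in *.
  set (Q := lsum (fun k => g k ^ 2) l) in *.
  (* the cross terms are compared by the inequality between the arithmetic
     and geometric means *)
  assert (2 * (f k * g k) * p <= f k ^ 2 * Q + P * g k ^ 2).
  { pose proof (sqrt_sqrt P Hf); pose proof (sqrt_sqrt Q Hg).
    assert (Rabs p <= sqrt P * sqrt Q).
    { rewrite <- sqrt_mult by assumption; apply Rsqr_incr_0_var;
        [|apply sqrt_pos].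
      rewrite Rsqr_sqrt by nra; rewrite <- Rsqr_abs; unfold Rsqr; lra. }
    assert (f k * g k * p <= Rabs (f k) * Rabs (g k) * (sqrt P * sqrt Q)).
    { eapply Rle_trans; [apply Rle_abs|]; rewrite !Rabs_mult.
      apply Rmult_le_compat_l; [|assumption].
      apply Rmult_le_pos; apply Rabs_pos. }
    pose proof (pow2_ge_0 (Rabs (f k) * sqrt Q - Rabs (g k) * sqrt P)).
    rewrite <- (pow2_abs (f k)), <- (pow2_abs (g k)); nra. }
  nra.
Qed.

Lemma lsum_Minkowski f g l K L :
  0 <= K -> 0 <= L -> lsum (fun k => f k ^ 2) l <= K ^ 2 ->
  lsum (fun k => g k ^ 2) l <= L ^ 2 ->
  lsum (fun k => (f k + g k) ^ 2) l <= (K + L) ^ 2.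
Proof.
  intros HK HL Hf Hg.
  rewrite (lsum_ext _ (fun k => (f k ^ 2 + 2 * (f k * g k)) + g k ^ 2))
    by (intros; ring).
  rewrite !lsum_plus, lsum_scal.
  assert (H := lsum_Cauchy_Schwarz f g l).
  assert (0 <= lsum (fun k => f k ^ 2) l)
    by (apply lsum_nonneg; intros; apply pow2_ge_0).
  assert (0 <= lsum (fun k => g k ^ 2) l)
    by (apply lsum_nonneg; intros; apply pow2_ge_0).
  assert (lsum (fun k => f k * g k) l <= K * L).
  { apply Rsqr_incr_0_var; [|nra].
    unfold Rsqr.
    assert (lsum (fun k => f k ^ 2) l * lsum (fun k => g k ^ 2) l
            <= K ^ 2 * L ^ 2) by (apply Rmult_le_compat; assumption).
    nra. }
  nra.
Qed.

(** * Series with nonnegative terms *)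

Lemma sum_n_lsum (a : nat -> R) n : sum_n a n = lsum a (seq 0 (S n)).
Proof.
  induction n as [|n IH].
  - rewrite sum_O; unfold lsum; simpl; ring.
  - rewrite sum_Sn, IH, (lsum_seq_S _ (S n)); reflexivity.
Qed.

Lemma sum_n_csum (a : nat -> C) n :
  sum_n (G := C_AbelianGroup) a n = csum a (seq 0 (S n)).
Proof.
  induction n as [|n IH].
  - rewrite sum_O; unfold csum; simpl; ring.
  - rewrite sum_Sn, IH, (seq_S (S n)), csum_app.
    unfold csum at 3; simpl; unfold plus; simpl; ring.
Qed.

Lemma is_series_lsum (a : nat -> R) (s : R) :
  is_series a s <-> is_lim_seq (fun n => lsum a (seq 0 n)) s.
Proof.
  unfold is_series; rewrite (is_lim_seq_incr_1 (fun n => lsum a (seq 0 n))).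
  split; intro H.
  - apply (is_lim_seq_ext (sum_n a)); [apply sum_n_lsum|exact H].
  - apply (is_lim_seq_ext _ (sum_n a)) in H; [exact H|].
    intro n; symmetry; apply sum_n_lsum.
Qed.

Lemma lsum_seq_mono (a : nat -> R) : (forall k, 0 <= a k) ->
  forall n m, (n <= m)%nat -> lsum a (seq 0 n) <= lsum a (seq 0 m).
Proof.
  intros Ha n m Hnm.
  replace m with (n + (m - n))%nat by lia.
  rewrite seq_app, lsum_app.
  assert (0 <= lsum a (seq (0 + n) (m - n)))
    by (apply lsum_nonneg; intros; apply Ha); lra.
Qed.

Lemma lsum_le_Series (a : nat -> R) n :
  (forall k, 0 <= a k) -> ex_series a -> lsum a (seq 0 n) <= Series a.
Proof.
  intros Ha Hs; apply Series_correct, is_series_lsum in Hs.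
  apply (is_lim_seq_incr_compare _ _ Hs).
  intro k; apply lsum_seq_mono; [assumption|lia].
Qed.

Lemma ex_series_bounded (a : nat -> R) (M : R) :
  (forall k, 0 <= a k) -> (forall n, lsum a (seq 0 n) <= M) ->
  ex_series a /\ Series a <= M.
Proof.
  intros Ha HM.
  destruct (ex_finite_lim_seq_incr (fun n => lsum a (seq 0 n)) M) as [s Hs].
  - intro n; apply lsum_seq_mono; [assumption|lia].
  - assumption.
  - assert (H : is_series a s) by (apply is_series_lsum; exact Hs).
    split; [exists s; exact H|].
    rewrite (is_series_unique _ _ H).
    apply (is_lim_seq_le _ _ s M HM Hs), is_lim_seq_const.
Qed.

Lemma ell2_bounded (x : omega) (M : R) : 0 <= M ->
  (forall n, lsum (fun j => Cmod (x j) ^ 2) (seq 0 n) <= M ^ 2) ->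
  ell2 x /\ ell2_norm x <= M.
Proof.
  intros HM H.
  destruct (ex_series_bounded (fun j => Cmod (x j) ^ 2) (M ^ 2)) as [H1 H2].
  - intro; apply pow2_ge_0.
  - assumption.
  - split; [exact H1|].
    unfold ell2_norm; rewrite <- (sqrt_pow2 M HM).
    apply sqrt_le_1_alt, H2.
Qed.

Lemma ell2_norm_nonneg x : 0 <= ell2_norm x.
Proof. apply sqrt_pos. Qed.

Lemma lsum_le_ell2 (x : omega) n : ell2 x ->
  lsum (fun j => Cmod (x j) ^ 2) (seq 0 n) <= ell2_norm x ^ 2.
Proof.
  intro H; unfold ell2_norm; rewrite pow2_sqrt.
  - apply lsum_le_Series; [intro; apply pow2_ge_0|exact H].
  - apply Rle_trans with (lsum (fun j => Cmod (x j) ^ 2) (seq 0 0)).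
    + apply lsum_nonneg; intros; apply pow2_ge_0.
    + apply lsum_le_Series; [intro; apply pow2_ge_0|exact H].
Qed.

Lemma ell2_norm_coord (x : omega) j : ell2 x -> Cmod (x j) <= ell2_norm x.
Proof.
  intro H; apply Rsqr_incr_0_var; [|apply ell2_norm_nonneg].
  unfold Rsqr; apply Rle_trans with (ell2_norm x ^ 2); [|lra].
  eapply Rle_trans; [|apply (lsum_le_ell2 x (S j) H)].
  replace (Cmod (x j) * Cmod (x j)) with (Cmod (x j) ^ 2) by ring.
  apply (lsum_in (fun j => Cmod (x j) ^ 2)); [intros; apply pow2_ge_0|].
  apply in_seq; lia.
Qed.

(** * Local expansions *)

Definition bounded_near_0 (f : C -> C) : Prop :=
  exists r K, 0 < r /\ forall w, Cmod w < r -> Cmod (f w) <= K.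

(** Iterated difference quotients at the origin: [f] has a Taylor polynomial of
    degree [n - 1] there, with a remainder of the form [w ^ n] times a bounded
    function.  Keeping the remainder as an exact factor makes the closure
    properties below purely algebraic. *)
Fixpoint jet (n : nat) (f : C -> C) : Prop :=
  match n with
  | O => bounded_near_0 f
  | S n => exists a g r, 0 < r /\
      (forall w, Cmod w < r -> f w = (a + w * g w)%C) /\ jet n g
  end.

Lemma jet_ext n f g r : 0 < r -> (forall w, Cmod w < r -> f w = g w) ->
  jet n f -> jet n g.
Proof.
  destruct n as [|n]; intros Hr H.
  - intros (s & K & Hs & Hf); exists (Rmin r s), K.
    split; [apply Rmin_glb_lt; assumption|].
    intros w Hw; rewrite <- H; [apply Hf|];
      eapply Rlt_le_trans; try exact Hw; [apply Rmin_r|apply Rmin_l].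
  - intros (a & h & s & Hs & Hf & Hh); exists a, h, (Rmin r s).
    split; [apply Rmin_glb_lt; assumption|split; [|exact Hh]].
    intros w Hw; rewrite <- H; [apply Hf|];
      eapply Rlt_le_trans; try exact Hw; [apply Rmin_r|apply Rmin_l].
Qed.

Lemma bounded_near_0_plus f g : bounded_near_0 f -> bounded_near_0 g ->
  bounded_near_0 (fun w => f w + g w)%C.
Proof.
  intros (r & K & Hr & Hf) (s & L & Hs & Hg).
  exists (Rmin r s), (K + L); split; [apply Rmin_glb_lt; assumption|].
  intros w Hw; eapply Rle_trans; [apply Cmod_triangle|].
  apply Rplus_le_compat; [apply Hf|apply Hg];
    eapply Rlt_le_trans; try exact Hw; [apply Rmin_l|apply Rmin_r].
Qed.

Lemma bounded_near_0_mult f g : bounded_near_0 f -> bounded_near_0 g ->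
  bounded_near_0 (fun w => f w * g w)%C.
Proof.
  intros (r & K & Hr & Hf) (s & L & Hs & Hg).
  exists (Rmin r s), (K * L); split; [apply Rmin_glb_lt; assumption|].
  intros w Hw; rewrite Cmod_mult.
  apply Rmult_le_compat; try apply Cmod_ge_0; [apply Hf|apply Hg];
    eapply Rlt_le_trans; try exact Hw; [apply Rmin_l|apply Rmin_r].
Qed.

Lemma bounded_near_0_const a : bounded_near_0 (fun _ => a).
Proof. exists 1, (Cmod a); split; [lra|intros; apply Rle_refl]. Qed.

Lemma bounded_near_0_id : bounded_near_0 (fun w => w).
Proof. exists 1, 1; split; [lra|intros; lra]. Qed.

Lemma jet_bounded n f : jet n f -> bounded_near_0 f.
Proof.
  revert f; induction n as [|n IH]; intros f; [trivial|].
  intros (a & g & r & Hr & Hf & Hg).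
  apply (jet_ext 0 (fun w => a + w * g w)%C f r Hr);
    [intros; symmetry; auto|].
  apply bounded_near_0_plus; [apply bounded_near_0_const|].
  apply bounded_near_0_mult; [apply bounded_near_0_id|auto].
Qed.

Lemma jet_pred n f : jet (S n) f -> jet n f.
Proof.
  revert f; induction n as [|n IH]; intros f.
  - apply jet_bounded.
  - intros (a & g & r & Hr & Hf & Hg).
    exists a, g, r; repeat split; auto.
Qed.

Lemma jet_le m n f : (m <= n)%nat -> jet n f -> jet m f.
Proof.
  intro H; induction H as [|n H IH]; [trivial|].
  intro J; apply IH, jet_pred, J.
Qed.

Lemma jet_const n a : jet n (fun _ => a).
Proof.
  revert a; induction n as [|n IH]; intro a; [apply bounded_near_0_const|].
  exists a, (fun _ => RtoC 0), 1; split; [lra|split; [intros; ring|apply IH]].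
Qed.

Lemma jet_plus n f g : jet n f -> jet n g -> jet n (fun w => f w + g w)%C.
Proof.
  revert f g; induction n as [|n IH]; intros f g.
  - apply bounded_near_0_plus.
  - intros (a & f' & r & Hr & Hf & Hf') (b & g' & s & Hs & Hg & Hg').
    exists (a + b)%C, (fun w => f' w + g' w)%C, (Rmin r s).
    split; [apply Rmin_glb_lt; assumption|split; [|apply IH; assumption]].
    intros w Hw; rewrite Hf, Hg; [ring| |];
      eapply Rlt_le_trans; try exact Hw; [apply Rmin_r|apply Rmin_l].
Qed.

Lemma jet_mult n f g : jet n f -> jet n g -> jet n (fun w => f w * g w)%C.
Proof.
  revert f g; induction n as [|n IH]; intros f g.
  - apply bounded_near_0_mult.
  - intros Jf (b & g' & s & Hs & Hg & Hg').
    assert (Jf0 := jet_pred _ _ Jf).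
    destruct Jf as (a & f' & r & Hr & Hf & Hf').
    exists (a * b)%C, (fun w => b * f' w + f w * g' w)%C, (Rmin r s).
    split; [apply Rmin_glb_lt; assumption|split].
    + intros w Hw; rewrite Hg, Hf; [ring| |];
        eapply Rlt_le_trans; try exact Hw; [apply Rmin_l|apply Rmin_r].
    + apply jet_plus; apply IH; auto using jet_const.
Qed.

Lemma jet_inv n c : c <> RtoC 0 -> jet n (fun w => / (c + w))%C.
Proof.
  intro Hc; assert (Hc' := proj1 (Cmod_gt_0 c) Hc).
  assert (Hlow : forall w, Cmod w < Cmod c / 2 -> Cmod c / 2 <= Cmod (c + w)).
  { intros w Hw; assert (H := Cmod_triangle (c + w) (- w)).
    replace (c + w + - w)%C with c in H by ring; rewrite Cmod_opp in H; lra. }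
  assert (Hnz : forall w, Cmod w < Cmod c / 2 -> (c + w)%C <> RtoC 0).
  { intros w Hw; apply Cmod_gt_0; specialize (Hlow w Hw); lra. }
  induction n as [|n IH].
  - exists (Cmod c / 2), (/ (Cmod c / 2)); split; [lra|].
    intros w Hw; rewrite Cmod_inv by auto.
    apply Rinv_le_contravar; [lra|auto].
  - exists (/ c)%C, (fun w => (- / c) * / (c + w))%C, (Cmod c / 2).
    split; [lra|split].
    + intros w Hw; field; split; auto.
    + apply jet_mult; [apply jet_const|exact IH].
Qed.

Lemma is_derive_C f z l :
  (exists r K, 0 < r /\ forall w, Cmod w < r ->
     Cmod (f (z + w) - f z - w * l)%C <= K * Cmod w * Cmod w) ->
  is_derive (K := C_AbsRing) (V := C_NormedModule) f z l.
Proof.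
  intros (r & K & Hr & H).
  split; [apply is_linear_scal_l|].
  intros x Hx.
  assert (E : x = z).
  { symmetry.
    apply (is_filter_lim_locally_unique (K := C_AbsRing)
             (V := AbsRing_NormedModule C_AbsRing)); exact Hx. }
  subst x; intro eps.
  assert (HK : 0 < Rabs K + 1) by (assert (G := Rabs_pos K); lra).
  assert (Hd : 0 < Rmin r (eps / (Rabs K + 1))).
  { apply Rmin_glb_lt; [assumption|].
    apply Rdiv_lt_0_compat; [apply cond_pos|assumption]. }
  exists (mkposreal _ Hd); intros y Hy.
  change (Cmod (y - z)%C < Rmin r (eps / (Rabs K + 1))) in Hy.
  change (Cmod (f y - f z - (y - z) * l)%C <= eps * Cmod (y - z)%C).
  assert (H1 := H (y - z)%C).
  assert (Hyz : forall p q : C, (q + (p - q))%C = p) by (intros; ring).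
  rewrite Hyz in H1.
  assert (Hr' := Rmin_l r (eps / (Rabs K + 1))).
  assert (He' := Rmin_r r (eps / (Rabs K + 1))).
  eapply Rle_trans; [apply H1; lra|].
  apply Rmult_le_compat_r; [apply Cmod_ge_0|].
  apply Rle_trans with ((Rabs K + 1) * Cmod (y - z)%C).
  - apply Rmult_le_compat_r; [apply Cmod_ge_0|].
    assert (G := Rle_abs K); lra.
  - apply Rle_trans with ((Rabs K + 1) * (eps / (Rabs K + 1))).
    + apply Rmult_le_compat_l; lra.
    + right; field; lra.
Qed.

Lemma Cmod_0_lt r : 0 < r -> Cmod (RtoC 0) < r.
Proof. rewrite Cmod_0; trivial. Qed.

(** With one more expansion of [g], the difference quotients [g w] converge to
    [g 0] at a linear rate. *)
Lemma jet_is_derive f z a g r :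
  0 < r -> (forall w, Cmod w < r -> f (z + w)%C = (a + w * g w)%C) ->
  jet 1 g -> is_derive (K := C_AbsRing) (V := C_NormedModule) f z (g (RtoC 0)).
Proof.
  intros Hr Hf (b & h & s & Hs & Hg & t & K & Ht & Hh).
  apply is_derive_C.
  exists (Rmin r (Rmin s t)), K.
  split; [repeat apply Rmin_glb_lt; assumption|].
  intros w Hw.
  assert (Hwr : Cmod w < r) by (eapply Rlt_le_trans; [exact Hw|apply Rmin_l]).
  assert (Hw' : Cmod w < Rmin s t)
    by (eapply Rlt_le_trans; [exact Hw|apply Rmin_r]).
  assert (Hws : Cmod w < s) by (eapply Rlt_le_trans; [exact Hw'|apply Rmin_l]).
  assert (Hwt : Cmod w < t) by (eapply Rlt_le_trans; [exact Hw'|apply Rmin_r]).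
  assert (Hz : f z = a).
  { transitivity (f (z + RtoC 0)%C); [f_equal; ring|].
    rewrite Hf by (apply Cmod_0_lt; assumption); ring. }
  rewrite Hz, Hf, (Hg w), (Hg (RtoC 0)) by (assumption || apply Cmod_0_lt; assumption).
  replace (a + w * (b + w * h w) - a - w * (b + RtoC 0 * h (RtoC 0)))%C
    with (h w * (w * w))%C by ring.
  rewrite !Cmod_mult, Rmult_assoc.
  apply Rmult_le_compat_r; [|auto].
  apply Rmult_le_pos; apply Cmod_ge_0.
Qed.

Lemma is_derive_C_unique f (z l l' : C) :
  is_derive (K := C_AbsRing) (V := C_NormedModule) f z l ->
  is_derive (K := C_AbsRing) (V := C_NormedModule) f z l' -> l = l'.
Proof.
  intros H H'.
  rewrite <- (is_C_derive_unique _ _ _ H); apply is_C_derive_unique, H'.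
Qed.

(** * The maximum principle on the strip *)

(** If the supremum is not attained, every point has a neighbourhood on which
    [v] stays below the supremum by a margin, and by compactness one margin
    serves for the whole rectangle. *)
Lemma usc_attains_max (v : R -> R -> R) (a b c d B : R) :
  a <= b -> c <= d ->
  (forall x y, a <= x <= b -> c <= y <= d -> v x y <= B) ->
  (forall x y e, a <= x <= b -> c <= y <= d -> 0 < e -> exists delta,
     0 < delta /\ forall x' y', a <= x' <= b -> c <= y' <= d ->
       Rabs (x' - x) < delta -> Rabs (y' - y) < delta -> v x' y' < v x y + e) ->
  exists x0 y0, a <= x0 <= b /\ c <= y0 <= d /\
    forall x y, a <= x <= b -> c <= y <= d -> v x y <= v x0 y0.
Proof.
  intros Hab Hcd HB Husc.
  set (E := fun r => exists x y, a <= x <= b /\ c <= y <= d /\ r = v x y).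
  destruct (completeness E) as [s [Hub Hlub]].
  { exists B; intros r (x & y & Hx & Hy & ->); auto. }
  { exists (v a c), a, c; repeat split; lra. }
  assert (Hs : forall x y, a <= x <= b -> c <= y <= d -> v x y <= s).
  { intros x y Hx Hy; apply Hub; exists x, y; auto. }
  apply NNPP; intro Hno.
  assert (Hlt : forall x y, a <= x <= b -> c <= y <= d -> v x y < s).
  { intros x y Hx Hy; apply Rnot_le_lt; intro H; apply Hno.
    exists x, y; split; [|split]; auto.
    intros; eapply Rle_trans; [apply Hs|]; eauto. }
  assert (Hd : forall x y, exists delta : posreal,
    a <= x <= b -> c <= y <= d -> forall x' y', a <= x' <= b -> c <= y' <= d ->
      Rabs (x' - x) < delta -> Rabs (y' - y) < delta -> v x' y' < s - delta).
  { intros x y.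
    destruct (classic (a <= x <= b /\ c <= y <= d)) as [[Hx Hy]|H].
    - assert (He : 0 < (s - v x y) / 2) by (specialize (Hlt x y Hx Hy); lra).
      destruct (Husc x y _ Hx Hy He) as (delta & Hdelta & Hv).
      assert (Hm : 0 < Rmin delta ((s - v x y) / 2))
        by (apply Rmin_glb_lt; assumption).
      exists (mkposreal _ Hm); simpl; intros _ _ x' y' Hx' Hy' H1 H2.
      assert (G1 := Rmin_l delta ((s - v x y) / 2)).
      assert (G2 := Rmin_r delta ((s - v x y) / 2)).
      assert (G := Hv x' y' Hx' Hy' ltac:(lra) ltac:(lra)); lra.
    - exists (mkposreal 1 Rlt_0_1); intros Hx Hy; exfalso; apply H; auto. }
  set (delta := fun x y => proj1_sig (constructive_indefinite_description _ (Hd x y))).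
  assert (Hdelta : forall x y, a <= x <= b -> c <= y <= d ->
    forall x' y', a <= x' <= b -> c <= y' <= d ->
      Rabs (x' - x) < delta x y -> Rabs (y' - y) < delta x y ->
      v x' y' < s - delta x y).
  { intros x y; unfold delta.
    destruct (constructive_indefinite_description _ (Hd x y)); simpl; auto. }
  destruct (compactness_value_2d a b c d delta) as [d0 Hd0].
  assert (Hs' : s <= s - d0).
  { apply Hlub; intros r (x & y & Hx & Hy & ->).
    apply Rnot_lt_le; intro Hlt'.
    apply (Hd0 x y Hx Hy); intros (u & t & Hu & Ht & H1 & H2 & H3).
    assert (G := Hdelta u t Hu Ht x y Hx Hy H1 H2); lra. }
  assert (G := cond_pos d0); lra.
Qed.

(** Averaging over the four points [s], [-s], [is], [-is] kills the linear and
    the quadratic term of an expansion, so that the square of the modulus of a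
    function is subharmonic up to an error of third order. *)
Lemma four_point_mean (f : C -> C) : jet 3 f ->
  exists r K, 0 < r /\ forall s, 0 < s < r ->
    4 * Cmod (f (RtoC 0)) ^ 2 - K * s ^ 3 <=
    Cmod (f (s, 0)) ^ 2 + Cmod (f (- s, 0)) ^ 2
    + Cmod (f (0, s)) ^ 2 + Cmod (f (0, - s)) ^ 2.
Proof.
  intros (a & f1 & r1 & Hr1 & Hf & b & f2 & r2 & Hr2 & Hf1 &
          c & f3 & r3 & Hr3 & Hf2 & r4 & K & Hr4 & Hf3).
  set (r := Rmin 1 (Rmin (Rmin r1 r2) (Rmin r3 r4))).
  assert (Hr : 0 < r) by (repeat apply Rmin_glb_lt; lra).
  set (p := fun w : C => (a + w * (b + w * c))%C).
  set (L := Cmod a + Cmod b + Cmod c).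
  assert (HL : 0 <= L).
  { assert (A := Cmod_ge_0 a); assert (B := Cmod_ge_0 b);
      assert (D := Cmod_ge_0 c); unfold L; lra. }
  exists r, (8 * L * K); split; [exact Hr|].
  assert (Hlow : forall w s, 0 < s < r -> Cmod w = s ->
    Cmod (p w) ^ 2 - 2 * L * K * s ^ 3 <= Cmod (f w) ^ 2).
  { intros w s Hs Hw.
    assert (s < 1 /\ s < r1 /\ s < r2 /\ s < r3 /\ s < r4)
      as (s0 & s1 & s2 & s3 & s4).
    { unfold r in Hs.
      assert (A := Rmin_l 1 (Rmin (Rmin r1 r2) (Rmin r3 r4))).
      assert (B := Rmin_r 1 (Rmin (Rmin r1 r2) (Rmin r3 r4))).
      assert (D := Rmin_l (Rmin r1 r2) (Rmin r3 r4)).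
      assert (E := Rmin_r (Rmin r1 r2) (Rmin r3 r4)).
      assert (F := Rmin_l r1 r2); assert (G := Rmin_r r1 r2).
      assert (H := Rmin_l r3 r4); assert (I := Rmin_r r3 r4).
      repeat split; lra. }
    rewrite (Hf w), (Hf1 w), (Hf2 w) by lra.
    set (e := (w * w * w * f3 w)%C).
    replace (a + w * (b + w * (c + w * f3 w)))%C with (p w + e)%C
      by (unfold p, e; ring).
    assert (He : Cmod e <= K * s ^ 3).
    { unfold e; rewrite !Cmod_mult, Hw.
      assert (A := Hf3 w ltac:(lra)).
      assert (0 <= s * s * s) by (apply Rmult_le_pos; nra); nra. }
    assert (Hp : Cmod (p w) <= L).
    { unfold p; eapply Rle_trans; [apply Cmod_triangle|].
      rewrite Cmod_mult, Hw.
      assert (A := Cmod_triangle b (w * c)); rewrite Cmod_mult, Hw in A.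
      assert (B := Cmod_ge_0 b); assert (D := Cmod_ge_0 c).
      assert (E := Cmod_ge_0 (b + w * c)%C).
      unfold L; nra. }
    assert (Ht : Cmod (p w) <= Cmod (p w + e) + Cmod e).
    { replace (p w) with (p w + e + - e)%C at 1 by ring.
      eapply Rle_trans; [apply Cmod_triangle|]; rewrite Cmod_opp; lra. }
    assert (A := Cmod_ge_0 (p w)); assert (B := Cmod_ge_0 (p w + e)).
    assert (D := Cmod_ge_0 e).
    assert (Cmod (p w) * Cmod e <= L * (K * s ^ 3))
      by (apply Rmult_le_compat; assumption).
    assert (0 <= Cmod (p w) * Cmod e) by (apply Rmult_le_pos; assumption).
    destruct (Rle_lt_dec (Cmod (p w)) (Cmod e)); [nra|].
    assert ((Cmod (p w) - Cmod e) ^ 2 <= Cmod (p w + e) ^ 2)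
      by (apply pow_incr; lra).
    nra. }
  intros s Hs.
  assert (Hf0 : f (RtoC 0) = a).
  { rewrite Hf by (apply Cmod_0_lt; assumption); ring. }
  rewrite Hf0.
  assert (M1 : Cmod (s, 0) = s).
  { change (s, 0) with (RtoC s); rewrite Cmod_R; apply Rabs_pos_eq; lra. }
  assert (M2 : Cmod (- s, 0) = s).
  { change (- s, 0) with (RtoC (- s)).
    rewrite Cmod_R, Rabs_Ropp; apply Rabs_pos_eq; lra. }
  assert (M3 : forall t, Rabs t = s -> Cmod (0, t) = s).
  { intros t Ht; unfold Cmod; simpl.
    replace (0 * (0 * 1) + t * (t * 1)) with (Rsqr t) by (unfold Rsqr; ring).
    rewrite sqrt_Rsqr_abs; exact Ht. }
  assert (P1 := Hlow _ s Hs M1); assert (P2 := Hlow _ s Hs M2).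
  assert (P3 := Hlow _ s Hs (M3 s (Rabs_pos_eq s ltac:(lra)))).
  assert (P4 := Hlow _ s Hs (M3 (- s) (eq_trans (Rabs_Ropp s)
                  (Rabs_pos_eq s ltac:(lra))))).
  assert (HP : 4 * Cmod a ^ 2 <= Cmod (p (s, 0)) ^ 2 + Cmod (p (- s, 0)) ^ 2
                + Cmod (p (0, s)) ^ 2 + Cmod (p (0, - s)) ^ 2).
  { rewrite !Cmod2_alt; unfold Re, Im.
    destruct a as [a1 a2], b as [b1 b2], c as [c1 c2].
    unfold p; simpl.
    match goal with |- ?X <= ?Y =>
      assert (Y - X = 4 * s ^ 2 * (b1 ^ 2 + b2 ^ 2)
              + 4 * (s ^ 2) ^ 2 * (c1 ^ 2 + c2 ^ 2)) by ring end.
    assert (0 <= s ^ 2 * (b1 ^ 2 + b2 ^ 2))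
      by (apply Rmult_le_pos; [apply pow2_ge_0|nra]).
    assert (0 <= (s ^ 2) ^ 2 * (c1 ^ 2 + c2 ^ 2))
      by (apply Rmult_le_pos; [apply pow2_ge_0|nra]).
    lra. }
  lra.
Qed.

Definition continuous_on_strip_at (f : C -> C) (z : C) : Prop :=
  forall e, 0 < e -> exists d, 0 < d /\
    forall w, strip w -> Cmod (w - z)%C < d -> Cmod (f w - f z)%C < e.

Definition strip_continuous (f : C -> C) : Prop :=
  forall z, strip z -> continuous_on_strip_at f z.

(** A perturbation of [|g|^2] that tends to [-oo] at the ends of the strip
    attains its maximum on a rectangle; being strictly subharmonic, in the sense
    of [four_point_mean], it does so on the boundary of the strip. *)
Lemma strip_max_principle (g : C -> C) (B M : R) :
  (forall z, strip z -> Cmod (g z) <= B) ->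
  strip_continuous g ->
  (forall z, strip_interior z -> jet 3 (fun w => g (z + w)%C)) ->
  (forall t, Cmod (g (0, t)) <= M) -> (forall t, Cmod (g (1, t)) <= M) ->
  Cmod (g (RtoC (1 / 2))) <= M.
Proof.
  intros HB Hcont Hjet H0 H1.
  assert (HM : 0 <= M) by (eapply Rle_trans; [apply Cmod_ge_0|apply (H0 0)]).
  apply Rnot_lt_le; intro Hlt.
  set (u := Cmod (g (RtoC (1 / 2))) ^ 2).
  assert (Hu : M ^ 2 < u) by (unfold u; nra).
  set (eps := (u - M ^ 2) / 4).
  assert (Heps : 0 < eps) by (unfold eps; lra).
  (* strictly subharmonic, as the square of the modulus is subharmonic and
     [2 x^2 - y^2] has positive Laplacian; tends to -oo at both ends *)
  set (v := fun x y => Cmod (g (x, y)) ^ 2 + 2 * eps * x ^ 2 - eps * y ^ 2).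
  set (Y := 1 + (B ^ 2 + 2 * eps) / eps).
  assert (HB0 : 0 <= B).
  { eapply Rle_trans; [apply Cmod_ge_0|apply (HB (0, 0))].
    unfold strip; simpl; lra. }
  assert (HgB : forall x y, 0 <= x <= 1 -> Cmod (g (x, y)) ^ 2 <= B ^ 2).
  { intros x y Hx; apply pow_incr; split; [apply Cmod_ge_0|].
    apply HB; exact Hx. }
  assert (HY1 : 1 <= Y).
  { unfold Y; assert (0 <= (B ^ 2 + 2 * eps) / eps); [|lra].
    apply Rmult_le_pos; [nra|apply Rlt_le, Rinv_0_lt_compat; exact Heps]. }
  assert (HY : B ^ 2 + 2 * eps < eps * Y ^ 2).
  { assert (eps * Y = eps + (B ^ 2 + 2 * eps)) by (unfold Y; field; lra).
    nra. }
  destruct (usc_attains_max v 0 1 (- Y) Y (B ^ 2 + 2 * eps))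
    as (x0 & y0 & Hx0 & Hy0 & Hmax); try lra.
  { intros x y Hx Hy; unfold v; assert (A := HgB x y Hx).
    assert (x ^ 2 <= 1) by nra; assert (0 <= eps * y ^ 2)
      by (apply Rmult_le_pos; [lra|apply pow2_ge_0]).
    nra. }
  { intros x y e Hx Hy He.
    assert (Hz : strip (x, y)) by exact Hx.
    set (e1 := e / (4 * (B + 1))).
    assert (He1 : 0 < e1) by (apply Rdiv_lt_0_compat; lra).
    destruct (Hcont _ Hz e1 He1) as (d & Hd & Hc).
    set (e2 := e / (2 * (eps * (4 + 2 * Y + 4)))).
    assert (Hden : 0 < 2 * (eps * (4 + 2 * Y + 4)))
      by (apply Rmult_lt_0_compat; [lra|apply Rmult_lt_0_compat; lra]).
    assert (He2 : 0 < e2) by (apply Rdiv_lt_0_compat; assumption).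
    exists (Rmin (d / 2) e2); split; [apply Rmin_glb_lt; lra|].
    intros x' y' Hx' Hy' Hdx Hdy.
    assert (G1 := Rmin_l (d / 2) e2); assert (G2 := Rmin_r (d / 2) e2).
    assert (Hdist : Cmod ((x', y') - (x, y))%C < d).
    { eapply Rle_lt_trans; [apply Cmod_2Rmax|]; simpl.
      assert (S2 : sqrt 2 < 2).
      { rewrite <- (sqrt_pow2 2) at 2 by lra; apply sqrt_lt_1; lra. }
      assert (S0 := sqrt_pos 2).
      assert (Rmax (Rabs (x' + - x)) (Rabs (y' + - y)) < d / 2)
        by (apply Rmax_lub_lt; unfold Rminus in *; lra).
      assert (0 <= Rmax (Rabs (x' + - x)) (Rabs (y' + - y)))
        by (eapply Rle_trans; [apply Rabs_pos|apply Rmax_l]).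
      nra. }
    assert (Hg := Hc (x', y') Hx' Hdist).
    assert (A : Cmod (g (x', y')) ^ 2 < Cmod (g (x, y)) ^ 2 + e / 2).
    { assert (T := Cmod_triangle (g (x', y') - g (x, y))%C (g (x, y))).
      replace (g (x', y') - g (x, y) + g (x, y))%C with (g (x', y')) in T
        by ring.
      assert (P := HB _ Hz); assert (P' := HB (x', y') Hx').
      assert (Q := Cmod_ge_0 (g (x, y))); assert (Q' := Cmod_ge_0 (g (x', y'))).
      assert (E1 : e1 * (4 * (B + 1)) = e) by (unfold e1; field; lra).
      assert ((Cmod (g (x', y')) - Cmod (g (x, y)))
              * (Cmod (g (x', y')) + Cmod (g (x, y))) <= e1 * (2 * B)).
      { destruct (Rle_lt_dec (Cmod (g (x', y'))) (Cmod (g (x, y)))); nra. }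
      nra. }
    assert (D : 2 * eps * x' ^ 2 - eps * y' ^ 2
                <= 2 * eps * x ^ 2 - eps * y ^ 2 + e / 2).
    { assert (E2 : e2 * (eps * (4 + 2 * Y + 4)) = e / 2)
        by (unfold e2; field; split; lra).
      apply Rabs_def2 in Hdx; apply Rabs_def2 in Hdy.
      assert (2 * (x' ^ 2 - x ^ 2) <= e2 * 4) by nra.
      assert (- (y' ^ 2 - y ^ 2) <= e2 * (2 * Y)) by nra.
      assert (2 * (x' ^ 2 - x ^ 2) - (y' ^ 2 - y ^ 2)
              <= e2 * (4 + 2 * Y + 4)) by lra.
      nra. }
    unfold v; lra. }
  assert (Hmid : u < v x0 y0).
  { apply Rlt_le_trans with (v (1 / 2) 0); [|apply Hmax; lra].
    unfold v; fold (RtoC (1 / 2)); fold u; lra. }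
  assert (Hxi : 0 < x0 < 1).
  { destruct (Rle_lt_dec x0 0).
    { assert (x0 = 0) by lra; subst x0.
      assert (A := H0 y0); assert (Q := Cmod_ge_0 (g (0, y0))).
      unfold v in Hmid; nra. }
    destruct (Rle_lt_dec 1 x0); [|lra].
    assert (x0 = 1) by lra; subst x0.
    assert (A := H1 y0); assert (Q := Cmod_ge_0 (g (1, y0))).
    assert (4 * eps = u - M ^ 2) by (unfold eps; field).
    unfold v in Hmid; nra. }
  assert (Hyi : - Y < y0 < Y).
  { assert (A := HgB x0 y0 Hx0).
    assert (0 <= u) by (unfold u; apply pow2_ge_0).
    assert (eps * x0 ^ 2 <= eps * 1) by (apply Rmult_le_compat_l; nra).
    unfold v in Hmid; split; apply Rnot_le_lt; intro Hle.
    - assert (y0 = - Y) by lra; subst y0.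
      replace ((- Y) ^ 2) with (Y ^ 2) in Hmid by ring; nra.
    - assert (y0 = Y) by lra; subst y0; nra. }
  assert (Hj : jet 3 (fun w => g ((x0, y0) + w)%C)) by (apply Hjet; exact Hxi).
  destruct (four_point_mean _ Hj) as (r & K & Hr & Hmean).
  set (m := Rmin (Rmin x0 (1 - x0)) (Rmin (Y - y0) (Y + y0))).
  assert (Hm : 0 < m) by (repeat apply Rmin_glb_lt; lra).
  set (s := Rmin (Rmin (r / 2) m) (eps / (Rabs K + 1))).
  assert (HK : 0 < Rabs K + 1) by (assert (A := Rabs_pos K); lra).
  assert (Hs : 0 < s).
  { repeat apply Rmin_glb_lt; try lra; apply Rdiv_lt_0_compat; assumption. }
  assert (Hs1 : s <= r / 2 /\ s <= m /\ s <= eps / (Rabs K + 1)).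
  { unfold s; repeat split.
    - eapply Rle_trans; [apply Rmin_l|apply Rmin_l].
    - eapply Rle_trans; [apply Rmin_l|apply Rmin_r].
    - apply Rmin_r. }
  destruct Hs1 as (Hsr & Hsm & HsK).
  assert (Hm' : m <= x0 /\ m <= 1 - x0 /\ m <= Y - y0 /\ m <= Y + y0).
  { unfold m; repeat split.
    - eapply Rle_trans; [apply Rmin_l|apply Rmin_l].
    - eapply Rle_trans; [apply Rmin_l|apply Rmin_r].
    - eapply Rle_trans; [apply Rmin_r|apply Rmin_l].
    - eapply Rle_trans; [apply Rmin_r|apply Rmin_r]. }
  assert (Hmean' := Hmean s ltac:(lra)).
  assert (V1 := Hmax (x0 + s) y0 ltac:(lra) ltac:(lra)).
  assert (V2 := Hmax (x0 + - s) y0 ltac:(lra) ltac:(lra)).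
  assert (V3 := Hmax x0 (y0 + s) ltac:(lra) ltac:(lra)).
  assert (V4 := Hmax x0 (y0 + - s) ltac:(lra) ltac:(lra)).
  unfold v in V1, V2, V3, V4.
  assert (Hadd : forall a b, ((x0, y0) + (a, b))%C = (x0 + a, y0 + b))
    by reflexivity.
  unfold RtoC in Hmean'; rewrite !Hadd, !Rplus_0_r in Hmean'.
  assert (HKs : K * s ^ 3 < 2 * eps * s ^ 2).
  { assert (A := Rle_abs K).
    assert ((Rabs K + 1) * s <= eps).
    { apply Rle_trans with ((Rabs K + 1) * (eps / (Rabs K + 1))).
      - apply Rmult_le_compat_l; lra.
      - right; field; lra. }
    assert (K * s <= eps) by nra.
    assert (0 < s ^ 2) by nra.
    replace (K * s ^ 3) with (K * s * s ^ 2) by ring; nra. }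
  lra.
Qed.

(** * Power series and the complex exponential *)

Lemma is_series_C (a : nat -> C) (l : C) :
  is_series (K := C_AbsRing) (V := C_NormedModule) a l <->
  forall e, 0 < e -> exists N, forall n, (N <= n)%nat ->
    Cmod (csum a (seq 0 n) - l)%C < e.
Proof.
  unfold is_series; split.
  - intros H e He.
    apply (proj1 (filterlim_locally_ball_norm (K := C_AbsRing)
             (U := C_NormedModule) (F := eventually) _ _)) with
      (eps := mkposreal e He) in H.
    destruct H as [N HN]; exists (S N); intros n Hn.
    destruct n as [|n]; [lia|].
    rewrite <- sum_n_csum; apply (HN n); lia.
  - intro H; apply (proj2 (filterlim_locally_ball_norm (K := C_AbsRing)
             (U := C_NormedModule) (F := eventually) _ _)).
    intro e; destruct (H e (cond_pos e)) as [N HN]; exists N; intros n Hn.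
    change (Cmod (sum_n (G := C_AbelianGroup) a n - l)%C < e).
    rewrite sum_n_csum; apply HN; lia.
Qed.

Lemma Cmod_triangle_rev (z w : C) : Cmod z <= Cmod w + Cmod (z - w)%C.
Proof.
  replace z with (w + (z - w))%C at 1 by ring; apply Cmod_triangle.
Qed.

Lemma Cmod_minus_sym (z w : C) : Cmod (z - w)%C = Cmod (w - z)%C.
Proof. rewrite <- Cmod_opp; f_equal; ring. Qed.

Lemma is_series_C_unique (a : nat -> C) (l l' : C) :
  is_series (K := C_AbsRing) (V := C_NormedModule) a l ->
  is_series (K := C_AbsRing) (V := C_NormedModule) a l' -> l = l'.
Proof.
  rewrite !is_series_C; intros H H'.
  apply Ceq_minus, Cmod_eq_0.
  apply Rle_antisym; [|apply Cmod_ge_0]; apply Rnot_lt_le; intro Hlt.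
  destruct (H (Cmod (l - l')%C / 2)) as [N HN]; [lra|].
  destruct (H' (Cmod (l - l')%C / 2)) as [N' HN']; [lra|].
  specialize (HN _ (Nat.le_max_l N N')); specialize (HN' _ (Nat.le_max_r N N')).
  set (s := csum a (seq 0 (Nat.max N N'))) in *.
  assert (T := Cmod_triangle (l - s) (s - l')).
  replace (l - s + (s - l'))%C with (l - l')%C in T by ring.
  rewrite (Cmod_minus_sym l s) in T; lra.
Qed.

Lemma is_series_C_bound (a : nat -> C) (l : C) (K : R) :
  is_series (K := C_AbsRing) (V := C_NormedModule) a l ->
  (forall n, Cmod (csum a (seq 0 n)) <= K) -> Cmod l <= K.
Proof.
  rewrite is_series_C; intros H HK.
  apply Rnot_lt_le; intro Hlt.
  destruct (H (Cmod l - K)) as [N HN]; [lra|].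
  specialize (HN N (le_n N)); specialize (HK N).
  rewrite Cmod_minus_sym in HN.
  assert (T := Cmod_triangle_rev l (csum a (seq 0 N))); lra.
Qed.

Lemma pow_n_Cpow (z : C) n : pow_n (K := C_Ring) z n = Cpow z n.
Proof.
  induction n as [|n IH]; [reflexivity|].
  simpl pow_n; rewrite IH, Cpow_S; reflexivity.
Qed.

Lemma is_series_C_terms_bounded (a : nat -> C) (l : C) :
  is_series (K := C_AbsRing) (V := C_NormedModule) a l ->
  exists K, forall n, Cmod (a n) <= K.
Proof.
  rewrite is_series_C; intro H.
  destruct (H 1 Rlt_0_1) as [N HN].
  assert (Hfin : forall m, exists K, forall n, (n < m)%nat -> Cmod (a n) <= K).
  { induction m as [|m [K HK]]; [exists 0; intros; lia|].
    exists (Rmax K (Cmod (a m))); intros n Hn.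
    destruct (Nat.eq_dec n m) as [->|]; [apply Rmax_r|].
    eapply Rle_trans; [apply HK; lia|apply Rmax_l]. }
  destruct (Hfin N) as [K HK].
  exists (Rmax K 2); intro n.
  destruct (Nat.lt_ge_cases n N).
  - eapply Rle_trans; [apply HK; assumption|apply Rmax_l].
  - eapply Rle_trans; [|apply Rmax_r].
    assert (H1 := HN n ltac:(assumption)); assert (H2 := HN (S n) ltac:(lia)).
    rewrite seq_S, csum_app in H2; unfold csum at 2 in H2; simpl in H2.
    set (s := csum a (seq 0 n)) in *.
    assert (T := Cmod_triangle_rev (s + (a n + RtoC 0) - l) (s - l)).
    assert (T' := Cmod_triangle_rev (a n) (s + (a n + RtoC 0) - l)).
    replace (a n - (s + (a n + RtoC 0) - l))%C with (- (s - l))%C in T' by ring.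
    rewrite Cmod_opp in T'; lra.
Qed.

Lemma pseries_bounded (a : nat -> C) (f : C -> C) r : 0 < r ->
  (forall w, Cmod w < r ->
     is_pseries (K := C_AbsRing) (V := C_NormedModule) a w (f w)) ->
  bounded_near_0 f.
Proof.
  intros Hr H.
  assert (Hw0 : Cmod (RtoC (r / 2)) = r / 2)
    by (rewrite Cmod_R; apply Rabs_pos_eq; lra).
  destruct (is_series_C_terms_bounded _ _ (H (RtoC (r / 2)) ltac:(lra)))
    as [K HK].
  exists (r / 4), (2 * K); split; [lra|]; intros w Hw.
  apply (is_series_C_bound _ _ (2 * K) (H w ltac:(lra))); intro n.
  eapply Rle_trans; [apply csum_Cmod|].
  (* comparison with the geometric series of ratio 1/2 *)
  assert (HK0 : 0 <= K)
    by (eapply Rle_trans; [apply Cmod_ge_0|apply (HK 0%nat)]).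
  apply Rle_trans with (lsum (fun k => K * (1 / 2) ^ k) (seq 0 n)).
  - apply lsum_le; intros k _; specialize (HK k).
    change (Cmod (pow_n (K := C_Ring) (RtoC (r / 2)) k * a k)%C <= K) in HK.
    change (Cmod (pow_n (K := C_Ring) w k * a k)%C <= K * (1 / 2) ^ k).
    rewrite pow_n_Cpow, Cmod_mult, Cmod_pow in HK |- *; rewrite Hw0 in HK.
    apply Rle_trans with (((1 / 2) ^ k * (r / 2) ^ k) * Cmod (a k)).
    + apply Rmult_le_compat_r; [apply Cmod_ge_0|].
      rewrite <- Rpow_mult_distr; apply pow_incr.
      split; [apply Cmod_ge_0|lra].
    + rewrite Rmult_assoc, Rmult_comm; apply Rmult_le_compat_r; [|exact HK].
      apply pow_le; lra.
  - rewrite lsum_scal, Rmult_comm; apply Rmult_le_compat_r; [exact HK0|].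
    assert (G := is_series_geom (1 / 2) ltac:(rewrite Rabs_pos_eq; lra)).
    apply Rle_trans with (Series (fun k => (1 / 2) ^ k)).
    + apply lsum_le_Series; [intro; apply pow_le; lra|eexists; exact G].
    + rewrite (is_series_unique _ _ G); right; field.
Qed.

(** Shifting the coefficients divides a power series by the variable, once the
    constant term is removed; by iteration analytic functions have expansions of
    every order. *)
Lemma pseries_quotient (a : nat -> C) (f : C -> C) r : 0 < r ->
  (forall w, Cmod w < r ->
     is_pseries (K := C_AbsRing) (V := C_NormedModule) a w (f w)) ->
  exists g, g (RtoC 0) = a 1%nat /\
    (forall w, Cmod w < r -> f w = (a 0%nat + w * g w)%C) /\
    (forall w, Cmod w < r ->
       is_pseries (K := C_AbsRing) (V := C_NormedModule)
         (PS_decr_1 (V := C_NormedModule) a) w (g w)).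
Proof.
  intros Hr H.
  assert (Hf0 : f (RtoC 0) = a 0%nat).
  { eapply is_series_C_unique; [apply (H (RtoC 0)), Cmod_0_lt, Hr|].
    apply (is_pseries_0 (K := C_AbsRing) (V := C_NormedModule) a). }
  exists (fun w => if Ceq_dec w (RtoC 0) then a 1%nat
                   else (/ w * (f w - a 0%nat))%C).
  split; [|split].
  - destruct (Ceq_dec (RtoC 0) (RtoC 0)); [reflexivity|contradiction].
  - intros w Hw; destruct (Ceq_dec w (RtoC 0)) as [->|Hnz].
    + rewrite Hf0; ring.
    + field; exact Hnz.
  - intros w Hw; destruct (Ceq_dec w (RtoC 0)) as [->|Hnz].
    + apply (is_pseries_0 (K := C_AbsRing) (V := C_NormedModule)
               (PS_decr_1 (V := C_NormedModule) a)).
    + apply (is_pseries_decr_1 (K := C_AbsRing) (V := C_NormedModule)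
               a w (/ w)%C (f w)); [|apply H, Hw].
      apply (Cinv_l w Hnz).
Qed.

Lemma pseries_jet n : forall (a : nat -> C) (f : C -> C) r, 0 < r ->
  (forall w, Cmod w < r ->
     is_pseries (K := C_AbsRing) (V := C_NormedModule) a w (f w)) ->
  jet n f.
Proof.
  induction n as [|n IH]; intros a f r Hr H; [eapply pseries_bounded; eauto|].
  destruct (pseries_quotient a f r Hr H) as (g & _ & Hg & Hp).
  exists (a 0%nat), g, r; split; [exact Hr|split; [exact Hg|]].
  apply (IH _ g r Hr Hp).
Qed.

Lemma pseries_is_derive (a : nat -> C) (f : C -> C) z r : 0 < r ->
  (forall w, Cmod w < r ->
     is_pseries (K := C_AbsRing) (V := C_NormedModule) a w (f (z + w)%C)) ->
  is_derive (K := C_AbsRing) (V := C_NormedModule) f z (a 1%nat).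
Proof.
  intros Hr H.
  destruct (pseries_quotient a (fun w => f (z + w)%C) r Hr H)
    as (g & <- & Hg & Hp).
  apply (jet_is_derive f z _ g r Hr Hg), (pseries_jet 1 _ g r Hr Hp).
Qed.

Lemma analytic_jet n f z : analytic_at f z -> jet n (fun w => f (z + w)%C).
Proof.
  intros (a & r & Hr & H); apply (pseries_jet n a _ r Hr).
  intros w Hw.
  assert (E : w = (z + w - z)%C) by ring.
  rewrite E at 1; apply H; rewrite <- E; exact Hw.
Qed.

Lemma analytic_at_plus f g z :
  analytic_at f z -> analytic_at g z -> analytic_at (fun w => f w + g w)%C z.
Proof.
  intros (a & r & Hr & Hf) (b & s & Hs & Hg).
  exists (PS_plus (V := C_NormedModule) a b), (Rmin r s).
  split; [apply Rmin_glb_lt; assumption|]; intros w Hw.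
  apply (is_pseries_plus (K := C_AbsRing) (V := C_NormedModule));
    [apply Hf|apply Hg]; eapply Rlt_le_trans; try exact Hw;
    [apply Rmin_l|apply Rmin_r].
Qed.

Lemma analytic_at_scal c f z :
  analytic_at f z -> analytic_at (fun w => c * f w)%C z.
Proof.
  intros (a & r & Hr & Hf).
  exists (PS_scal (K := C_AbsRing) (V := C_NormedModule) c a), r.
  split; [exact Hr|]; intros w Hw.
  apply (is_pseries_scal (K := C_AbsRing) (V := C_NormedModule));
    [apply Cmult_comm|apply Hf, Hw].
Qed.

Definition cexp (z : C) : C := (exp (Re z) * cos (Im z), exp (Re z) * sin (Im z)).

Lemma cexp_plus z w : cexp (z + w)%C = (cexp z * cexp w)%C.
Proof.
  unfold cexp; rewrite re_plus, im_plus, exp_plus, cos_plus, sin_plus.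
  unfold Cmult; simpl; f_equal; ring.
Qed.

Lemma cexp_RtoC r : cexp (RtoC r) = RtoC (exp r).
Proof. unfold cexp; simpl; rewrite cos_0, sin_0; unfold RtoC; f_equal; ring. Qed.

Lemma cexp_0 : cexp (RtoC 0) = RtoC 1.
Proof. rewrite cexp_RtoC, exp_0; reflexivity. Qed.

Lemma Cmod_cexp z : Cmod (cexp z) = exp (Re z).
Proof.
  unfold Cmod, cexp; simpl.
  replace (_ + _) with (exp (Re z) ^ 2).
  - apply sqrt_pow2, Rlt_le, exp_pos.
  - assert (H := sin2_cos2 (Im z)); unfold Rsqr in H.
    transitivity (exp (Re z) ^ 2 * (sin (Im z) * sin (Im z) + cos (Im z) * cos (Im z)));
      [rewrite H; ring|ring].
Qed.

Lemma re_cexp_line_derive (c z : C) (t : R) :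
  is_derive (fun s : R => Re (c * cexp (RtoC s * z))%C) t
    (Re (c * z * cexp (RtoC t * z))%C).
Proof.
  destruct c as [c1 c2], z as [z1 z2]; unfold cexp, Re, Im; simpl.
  auto_derive; [trivial|].
  unfold Rminus; ring.
Qed.

(** Taylor's theorem on the segment from [0] to [z]: the successive derivatives
    of the real part of [c * cexp (t * z)] stay bounded for [|z| <= 1]. *)
Lemma re_cexp_series (c z : C) : Cmod c <= 1 -> Cmod z <= 1 ->
  is_series (fun n => Re (c * z ^ n)%C / INR (Factorial.fact n))
    (Re (c * cexp z)%C).
Proof.
  intros Hc Hz.
  set (E := fun c (s : R) => Re (c * cexp (RtoC s * z))%C).
  assert (HD : forall n t, Derive_n (E c) n t = E (c * z ^ n)%C t).
  { induction n as [|n IH]; intro t; simpl Derive_n.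
    - f_equal; simpl; ring.
    - rewrite (Derive_ext _ _ t IH).
      unfold E.
      rewrite (is_derive_unique _ _ _ (re_cexp_line_derive (c * z ^ n) z t)).
      rewrite Cpow_S; apply (f_equal Re); ring. }
  assert (H := mk_pseries (E c) (exp 2) 2).
  assert (H' : is_pseries (fun n => Derive_n (E c) n 0
                             / INR (Factorial.fact n)) 1 (E c 1)).
  { apply H.
    - intros n t Ht; split.
      + destruct n as [|n]; [exact I|]; simpl.
        apply (ex_derive_ext (E (c * z ^ n)%C)); [intro; symmetry; apply HD|].
        eexists; apply re_cexp_line_derive.
      + rewrite HD; unfold E.
        eapply Rle_trans; [apply re_le_Cmod|].
        rewrite !Cmod_mult, Cmod_pow, Cmod_cexp.
        assert (G : Cmod z ^ n <= 1).
        { rewrite <- (pow1 n); apply pow_incr; split; [apply Cmod_ge_0|exact Hz]. }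
        assert (G0 : 0 <= Cmod z ^ n) by (apply pow_le, Cmod_ge_0).
        assert (Gc := Cmod_ge_0 c).
        assert (Ge : exp (Re (RtoC t * z)%C) <= exp 2).
        { apply Rlt_le, exp_increasing.
          rewrite re_scal_l; simpl in Ht.
          eapply Rle_lt_trans; [apply Rle_abs|]; rewrite Rabs_mult.
          assert (Gz := re_le_Cmod z).
          assert (G1 := Rabs_pos t); assert (G2 := Rabs_pos (Re z)); nra. }
        assert (Ge0 := exp_pos (Re (RtoC t * z)%C)).
        assert (Cmod c * Cmod z ^ n <= 1) by nra.
        assert (0 <= Cmod c * Cmod z ^ n) by nra; nra.
    - simpl; rewrite Rabs_R1; lra. }
  apply is_pseries_R in H'.
  replace (Re (c * cexp z)%C) with (E c 1)
    by (unfold E; rewrite Cmult_1_l; reflexivity).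
  revert H'; apply is_series_ext; intro n.
  rewrite HD, pow1; unfold E.
  replace (RtoC 0 * z)%C with (RtoC 0) by ring; rewrite cexp_0.
  rewrite Cmult_1_r; apply Rmult_1_r.
Qed.

Lemma cexp_series (z : C) : Cmod z <= 1 ->
  is_series (K := C_AbsRing) (V := C_NormedModule)
    (fun n => z ^ n * RtoC (/ INR (Factorial.fact n)))%C (cexp z).
Proof.
  intro Hz.
  assert (HR := re_cexp_series (RtoC 1) z ltac:(rewrite Cmod_1; lra) Hz).
  assert (HI := re_cexp_series (- Ci)%C z
                  ltac:(rewrite Cmod_opp, Cmod_Ci; lra) Hz).
  apply is_series_lsum, is_lim_seq_spec in HR.
  apply is_series_lsum, is_lim_seq_spec in HI.
  apply is_series_C; intros e He.
  assert (He2 : 0 < e / 2) by lra.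
  destruct (HR (mkposreal _ He2)) as [N HN].
  destruct (HI (mkposreal _ He2)) as [N' HN'].
  exists (Nat.max N N'); intros n Hn.
  specialize (HN n ltac:(lia)); specialize (HN' n ltac:(lia)); simpl in HN, HN'.
  set (s := csum _ _).
  assert (Hs : forall c l, lsum (fun k => Re (c * z ^ k)%C
                          / INR (Factorial.fact k)) l
    = Re (c * csum (fun k => z ^ k * RtoC (/ INR (Factorial.fact k)))%C l)%C).
  { intros c l; induction l as [|k l IH].
    - unfold lsum, csum; simpl; ring.
    - rewrite lsum_cons, csum_cons, IH, Cmult_plus_distr_l, re_plus.
      f_equal; rewrite Cmult_assoc, re_scal_r; reflexivity. }
  change (Rabs (lsum (fun k => Re (RtoC 1 * z ^ k)%C / INR (Factorial.fact k))
            (seq 0 n) - Re (RtoC 1 * cexp z)%C) < e / 2) in HN.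
  change (Rabs (lsum (fun k => Re (- Ci * z ^ k)%C / INR (Factorial.fact k))
            (seq 0 n) - Re (- Ci * cexp z)%C) < e / 2) in HN'.
  rewrite Hs in HN, HN'; fold s in HN, HN'.
  assert (T : Cmod (s - cexp z)%C <= Rabs (Re (RtoC 1 * s)%C - Re (RtoC 1 * cexp z)%C)
              + Rabs (Re (- Ci * s)%C - Re (- Ci * cexp z)%C)).
  { generalize s (cexp z); intros [s1 s2] [x1 x2].
    replace (((s1, s2) : C) - (x1, x2))%C
      with (RtoC (s1 - x1) + Ci * RtoC (s2 - x2))%C
      by (unfold Cminus, Cplus, Cmult, Copp, RtoC, Ci; simpl; f_equal; ring).
    eapply Rle_trans; [apply Cmod_triangle|].
    rewrite Cmod_mult, Cmod_Ci, !Cmod_R; simpl.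
    right; rewrite Rmult_1_l; f_equal; f_equal; ring. }
  lra.
Qed.

(** A series for [|z| <= 1] is enough, since a translation of the argument
    multiplies the exponential by a constant. *)
Lemma cexp_pseries (lam z0 p z : C) : Cmod (z - z0)%C < / (1 + Cmod lam) ->
  is_pseries (K := C_AbsRing) (V := C_NormedModule)
    (fun n => cexp (lam * (z0 - p))
              * (lam ^ n * RtoC (/ INR (Factorial.fact n))))%C
    (z - z0)%C (cexp (lam * (z - p))%C).
Proof.
  intro Hz; assert (Hl := Cmod_ge_0 lam).
  assert (Hle : Cmod (lam * (z - z0))%C <= 1).
  { rewrite Cmod_mult.
    apply Rle_trans with (Cmod lam * / (1 + Cmod lam)).
    - apply Rmult_le_compat_l; lra.
    - apply Rmult_le_reg_r with (1 + Cmod lam); [lra|].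
      rewrite Rmult_assoc, Rinv_l; lra. }
  assert (H := is_series_scal (K := C_AbsRing) (V := C_NormedModule)
                 (cexp (lam * (z0 - p))%C) _ _ (cexp_series _ Hle)).
  unfold is_pseries.
  assert (Hv : cexp (lam * (z - p))%C
               = (cexp (lam * (z0 - p)) * cexp (lam * (z - z0)))%C)
    by (rewrite <- cexp_plus; f_equal; ring).
  rewrite Hv.
  apply (is_series_ext (K := C_AbsRing) (V := C_NormedModule)
           (fun n => cexp (lam * (z0 - p)) * ((lam * (z - z0)) ^ n
              * RtoC (/ INR (Factorial.fact n))))%C); [|exact H].
  intro n.
  change (@eq C (cexp (lam * (z0 - p)) * ((lam * (z - z0)) ^ n
              * RtoC (/ INR (Factorial.fact n))))%C
           (pow_n (K := C_Ring) (z - z0)%C n * (cexp (lam * (z0 - p))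
                  * (lam ^ n * RtoC (/ INR (Factorial.fact n)))))%C).
  rewrite (pow_n_Cpow (z - z0)%C n), Cpow_mult_l; ring.
Qed.

Lemma cexp_radius (lam : C) : 0 < / (1 + Cmod lam).
Proof. apply Rinv_0_lt_compat; assert (H := Cmod_ge_0 lam); lra. Qed.

Lemma cexp_analytic (lam p z0 : C) :
  analytic_at (fun z => cexp (lam * (z - p))%C) z0.
Proof.
  eexists; exists (/ (1 + Cmod lam)); split; [apply cexp_radius|].
  intros z Hz; apply cexp_pseries, Hz.
Qed.

Lemma cexp_is_derive (lam p : C) :
  is_derive (K := C_AbsRing) (V := C_NormedModule)
    (fun z => cexp (lam * (z - p))%C) p lam.
Proof.
  assert (Hone : (cexp (lam * (p - p))
    * (lam ^ 1 * RtoC (/ INR (Factorial.fact 1))))%C = lam).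
  { replace (p - p)%C with (RtoC 0) by ring.
    rewrite Cmult_0_r, cexp_0; simpl; rewrite Rinv_1; ring. }
  assert (H := pseries_is_derive (fun n => cexp (lam * (p - p))
              * (lam ^ n * RtoC (/ INR (Factorial.fact n))))%C
             (fun z => cexp (lam * (z - p))%C) p _ (cexp_radius lam)).
  cbv beta in H; rewrite Hone in H; apply H.
  intros w Hw.
  assert (E : w = (p + w - p)%C) by ring.
  rewrite E at 1; apply cexp_pseries; rewrite <- E; exact Hw.
Qed.

(** * Bounded holomorphic functions on the strip *)

Lemma continuous_on_strip_plus f g z :
  continuous_on_strip_at f z -> continuous_on_strip_at g z ->
  continuous_on_strip_at (fun w => f w + g w)%C z.
Proof.
  intros Hf Hg e He.
  destruct (Hf (e / 2)) as (d & Hd & Hfd); [lra|].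
  destruct (Hg (e / 2)) as (d' & Hd' & Hgd); [lra|].
  exists (Rmin d d'); split; [apply Rmin_glb_lt; assumption|].
  intros w Hw Hwd.
  assert (A := Rmin_l d d'); assert (B := Rmin_r d d').
  specialize (Hfd w Hw ltac:(lra)); specialize (Hgd w Hw ltac:(lra)).
  replace (f w + g w - (f z + g z))%C with (f w - f z + (g w - g z))%C by ring.
  eapply Rle_lt_trans; [apply Cmod_triangle|]; lra.
Qed.

Lemma continuous_on_strip_mult f g z :
  continuous_on_strip_at f z -> continuous_on_strip_at g z ->
  continuous_on_strip_at (fun w => f w * g w)%C z.
Proof.
  intros Hf Hg e He.
  set (K := Cmod (f z) + Cmod (g z) + 1).
  assert (F0 := Cmod_ge_0 (f z)); assert (G0 := Cmod_ge_0 (g z)).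
  assert (HK : 0 < K) by (unfold K; lra).
  assert (HeK : 0 < e / (2 * K)) by (apply Rdiv_lt_0_compat; lra).
  destruct (Hf _ HeK) as (d & Hd & Hfd).
  destruct (Hg (Rmin 1 (e / (2 * K)))) as (d' & Hd' & Hgd);
    [apply Rmin_glb_lt; lra|].
  exists (Rmin d d'); split; [apply Rmin_glb_lt; assumption|].
  intros w Hw Hwd.
  assert (A := Rmin_l d d'); assert (B := Rmin_r d d').
  specialize (Hfd w Hw ltac:(lra)); specialize (Hgd w Hw ltac:(lra)).
  assert (A' := Rmin_l 1 (e / (2 * K))); assert (B' := Rmin_r 1 (e / (2 * K))).
  assert (T := Cmod_triangle_rev (g w) (g z)).
  replace (f w * g w - f z * g z)%C
    with ((f w - f z) * g w + f z * (g w - g z))%C by ring.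
  eapply Rle_lt_trans; [apply Cmod_triangle|]; rewrite !Cmod_mult.
  assert (P := Cmod_ge_0 (f w - f z)%C); assert (Q := Cmod_ge_0 (g w)).
  assert (R1 : Cmod (g w) <= K) by (unfold K; lra).
  assert (R2 : Cmod (f z) <= K) by (unfold K; lra).
  assert (E : e / (2 * K) * K = e / 2) by (field; lra).
  assert (Cmod (f w - f z)%C * Cmod (g w) <= Cmod (f w - f z)%C * K)
    by (apply Rmult_le_compat_l; assumption).
  assert (Cmod (f w - f z)%C * K < e / (2 * K) * K)
    by (apply Rmult_lt_compat_r; assumption).
  assert (Cmod (f z) * Cmod (g w - g z)%C <= K * (e / (2 * K)))
    by (apply Rmult_le_compat; try apply Cmod_ge_0; lra).
  lra.
Qed.

Lemma continuous_on_strip_ext f g z r : 0 < r -> strip z ->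
  (forall w, strip w -> Cmod (w - z)%C < r -> f w = g w) ->
  continuous_on_strip_at f z -> continuous_on_strip_at g z.
Proof.
  intros Hr Hz Hfg Hf e He; destruct (Hf e He) as (d & Hd & Hfd).
  exists (Rmin r d); split; [apply Rmin_glb_lt; assumption|].
  intros w Hw Hwd.
  assert (A := Rmin_l r d); assert (B := Rmin_r r d).
  rewrite <- (Hfg w Hw), <- (Hfg z Hz); [apply Hfd; [assumption|lra]| |lra].
  replace (z - z)%C with (RtoC 0) by ring; apply Cmod_0_lt, Hr.
Qed.

Lemma jet_continuous f z :
  jet 1 (fun w => f (z + w)%C) -> continuous_on_strip_at f z.
Proof.
  intros (a & g & r & Hr & Hf & s & K & Hs & Hg) e He.
  assert (HK : 0 < Rabs K + 1) by (assert (A := Rabs_pos K); lra).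
  exists (Rmin (Rmin r s) (e / (Rabs K + 1))); split.
  { repeat apply Rmin_glb_lt; try assumption.
    apply Rdiv_lt_0_compat; assumption. }
  intros w _ Hw.
  assert (A := Rmin_l (Rmin r s) (e / (Rabs K + 1))).
  assert (B := Rmin_r (Rmin r s) (e / (Rabs K + 1))).
  assert (A' := Rmin_l r s); assert (B' := Rmin_r r s).
  assert (Hz : f z = a).
  { transitivity (f (z + RtoC 0)%C); [f_equal; ring|].
    rewrite Hf by (apply Cmod_0_lt; assumption); ring. }
  assert (Hw' : f w = (a + (w - z) * g (w - z))%C).
  { rewrite <- Hf by lra; f_equal; ring. }
  rewrite Hw', Hz.
  replace (a + (w - z) * g (w - z) - a)%C with ((w - z) * g (w - z))%C by ring.
  rewrite Cmod_mult.
  specialize (Hg (w - z)%C ltac:(lra)).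
  assert (C0 := Cmod_ge_0 (w - z)%C); assert (C1 := Cmod_ge_0 (g (w - z)%C)).
  apply Rle_lt_trans with (Cmod (w - z)%C * (Rabs K + 1)).
  - apply Rmult_le_compat_l; [assumption|].
    assert (D := Rle_abs K); lra.
  - apply Rlt_le_trans with (e / (Rabs K + 1) * (Rabs K + 1)).
    + apply Rmult_lt_compat_r; lra.
    + right; field; lra.
Qed.

Definition holo_strip (f : C -> C) : Prop :=
  (exists B, forall z, strip z -> Cmod (f z) <= B) /\
  strip_continuous f /\
  (forall n z, strip_interior z -> jet n (fun w => f (z + w)%C)).

Lemma holo_strip_const a : holo_strip (fun _ => a).
Proof.
  split; [|split].
  - exists (Cmod a); intros; apply Rle_refl.
  - intros z _; apply jet_continuous, jet_const.
  - intros; apply jet_const.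
Qed.

Lemma holo_strip_plus f g :
  holo_strip f -> holo_strip g -> holo_strip (fun z => f z + g z)%C.
Proof.
  intros ([B HB] & Hf & Jf) ([D HD] & Hg & Jg); split; [|split].
  - exists (B + D); intros z Hz; eapply Rle_trans; [apply Cmod_triangle|].
    apply Rplus_le_compat; auto.
  - intros z Hz; apply continuous_on_strip_plus; [exact (Hf z Hz)|exact (Hg z Hz)].
  - intros n z Hz; apply jet_plus; auto.
Qed.

Lemma holo_strip_mult f g :
  holo_strip f -> holo_strip g -> holo_strip (fun z => f z * g z)%C.
Proof.
  intros ([B HB] & Hf & Jf) ([D HD] & Hg & Jg); split; [|split].
  - exists (B * D); intros z Hz; rewrite Cmod_mult.
    apply Rmult_le_compat; auto using Cmod_ge_0.
  - intros z Hz; apply continuous_on_strip_mult; [exact (Hf z Hz)|exact (Hg z Hz)].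
  - intros n z Hz; apply jet_mult; auto.
Qed.

Lemma holo_strip_scal a f : holo_strip f -> holo_strip (fun z => a * f z)%C.
Proof. apply holo_strip_mult, holo_strip_const. Qed.

Lemma holo_strip_minus f g :
  holo_strip f -> holo_strip g -> holo_strip (fun z => f z - g z)%C.
Proof.
  intros Hf Hg; apply (holo_strip_plus f (fun z => - g z)%C Hf).
  replace (fun z => - g z)%C with (fun z => RtoC (-1) * g z)%C.
  - apply holo_strip_scal, Hg.
  - apply functional_extensionality; intro z; ring.
Qed.

Lemma holo_strip_csum (f : nat -> C -> C) l :
  (forall k, In k l -> holo_strip (f k)) ->
  holo_strip (fun z => csum (fun k => f k z) l).
Proof.
  induction l as [|k l IH]; intro H; [apply (holo_strip_const (RtoC 0))|].
  apply (holo_strip_plus (f k) (fun z => csum (fun k => f k z) l)).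
  - apply H; left; reflexivity.
  - apply IH; intros; apply H; right; assumption.
Qed.

Lemma is_derive_C_scal (c : C) f (z l : C) :
  is_derive (K := C_AbsRing) (V := C_NormedModule) f z l ->
  is_derive (K := C_AbsRing) (V := C_NormedModule)
    (fun w => c * f w)%C z (c * l)%C.
Proof.
  intro H.
  eapply filterdiff_ext_lin.
  - apply (filterdiff_scal_r_fct (K := C_AbsRing) (V := C_NormedModule)
             c f _ Cmult_comm H).
  - intro y; change (c * (y * l) = y * (c * l))%C; ring.
Qed.

Notation half := (RtoC (1 / 2)).

Lemma exp_le a b : a <= b -> exp a <= exp b.
Proof.
  intros [H| ->]; [apply Rlt_le, exp_increasing, H|apply Rle_refl].
Qed.

Lemma Re_half_exponent (lam : R) (z : C) :
  Re (RtoC lam * (z - half))%C = lam * (Re z - 1 / 2).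
Proof. rewrite re_scal_l; unfold Re; simpl; ring. Qed.

Lemma holo_strip_cexp (lam : R) :
  holo_strip (fun z => cexp (RtoC lam * (z - half))%C).
Proof.
  assert (J := fun n z => analytic_jet n _ z (cexp_analytic (RtoC lam) half z)).
  split; [|split].
  - exists (exp (Rabs lam)); intros z Hz; rewrite Cmod_cexp, Re_half_exponent.
    apply exp_le; unfold strip in Hz.
    assert (A := Rle_abs lam); assert (B := Rle_abs (- lam)).
    rewrite Rabs_Ropp in B; nra.
  - intros z _; apply jet_continuous, J.
  - intros n z _; apply J.
Qed.

Lemma strip_half : strip half /\ strip_interior half.
Proof. unfold strip, strip_interior; simpl; lra. Qed.

(** The point [1/2] is a removable singularity of [f z / (z - 1/2)]: the
    expansions of [f] there are divided by shifting them by one step. *)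
Lemma holo_strip_divide f : holo_strip f -> f half = RtoC 0 ->
  exists q, holo_strip q /\
    (forall z, z <> half -> q z = (f z * / (z - half))%C) /\
    is_derive (K := C_AbsRing) (V := C_NormedModule) f half (q half).
Proof.
  intros ([B HB] & Hf & Jf) H0.
  assert (Hg : forall n, exists g r, 0 < r /\
    (forall w, Cmod w < r -> f (half + w)%C = (w * g w)%C) /\ jet (S n) g /\
    is_derive (K := C_AbsRing) (V := C_NormedModule) f half (g (RtoC 0))).
  { intro n.
    destruct (Jf (S (S n)) half (proj2 strip_half)) as (a & g & r & Hr & Hg & Jg).
    assert (Ha : a = RtoC 0).
    { rewrite <- H0.
      transitivity (a + RtoC 0 * g (RtoC 0))%C; [ring|].
      rewrite <- Hg by (apply Cmod_0_lt, Hr); f_equal; ring. }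
    exists g, r; split; [exact Hr|split; [|split; [exact Jg|]]].
    - intros w Hw; rewrite Hg, Ha by exact Hw; ring.
    - apply (jet_is_derive f half a g r Hr Hg).
      apply (jet_le 1 (S n)); [lia|exact Jg]. }
  destruct (Hg 0%nat) as (g0 & r0 & Hr0 & Hg0 & Jg0 & Dg0).
  set (q := fun z => if Ceq_dec z half then g0 (RtoC 0)
                     else (f z * / (z - half))%C).
  assert (Hq1 : q half = g0 (RtoC 0)).
  { unfold q; destruct (Ceq_dec half half); [reflexivity|contradiction]. }
  assert (Hq2 : forall z, z <> half -> q z = (f z * / (z - half))%C).
  { intros z Hz; unfold q; destruct (Ceq_dec z half); [contradiction|trivial]. }
  assert (Jq : forall n, jet n (fun w => q (half + w)%C)).
  { intro n; destruct (Hg n) as (g & r & Hr & Hgw & Jg & Dg).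
    apply (jet_ext n g _ r Hr); [|apply jet_pred, Jg].
    intros w Hw; destruct (Ceq_dec w (RtoC 0)) as [->|Hnz].
    - replace (half + RtoC 0)%C with half by ring; rewrite Hq1.
      apply (is_derive_C_unique f half); assumption.
    - assert (Hne : (half + w)%C <> half).
      { intro E; apply Hnz.
        replace w with (half + w - half)%C by ring; rewrite E; ring. }
      rewrite Hq2 by exact Hne.
      rewrite Hgw by exact Hw.
      replace (half + w - half)%C with w by ring; field; exact Hnz. }
  assert (Jinv : forall n z, z <> half ->
    jet n (fun w => / (z + w - half))%C).
  { intros n z Hz; assert (J := jet_inv n (z - half)%C).
    apply (jet_ext n (fun w => / (z - half + w))%C _ 1); [lra| |].
    - intros w _; f_equal; ring.
    - apply J; intro E; apply Hz.
      replace z with (z - half + half)%C by ring; rewrite E; ring. }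
  assert (Hpos : forall z, z <> half -> 0 < Cmod (z - half)%C).
  { intros z Hz; apply Cmod_gt_0; intro E; apply Hz.
    replace z with (z - half + half)%C by ring; rewrite E; ring. }
  assert (Hnear : forall z w, z <> half -> Cmod (w - z)%C < Cmod (z - half)%C ->
    w <> half).
  { intros z w Hz Hw E; subst w; rewrite Cmod_minus_sym in Hw; lra. }
  exists q; split; [|split; [exact Hq2|rewrite Hq1; exact Dg0]].
  split; [|split].
  - destruct (Jq 0%nat) as (r & K & Hr & HK).
    exists (Rmax K (B * / r)); intros z Hz.
    destruct (Rlt_le_dec (Cmod (z - half)%C) r) as [Hlt|Hge].
    + eapply Rle_trans; [|apply Rmax_l].
      replace z with (half + (z - half))%C by ring; apply HK, Hlt.
    + eapply Rle_trans; [|apply Rmax_r].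
      assert (Hne : z <> half).
      { intro E; subst z; replace (half - half)%C with (RtoC 0) in Hge by ring.
        rewrite Cmod_0 in Hge; lra. }
      rewrite Hq2, Cmod_mult, Cmod_inv by
        (assumption || apply Cmod_gt_0, Hpos, Hne).
      apply Rmult_le_compat; auto using Cmod_ge_0.
      * apply Rlt_le, Rinv_0_lt_compat, Hpos, Hne.
      * apply Rinv_le_contravar; assumption.
  - intros z Hz; destruct (Ceq_dec z half) as [->|Hne].
    + apply jet_continuous, Jq.
    + apply (continuous_on_strip_ext (fun w => f w * / (w - half))%C _ z _
               (Hpos z Hne) Hz).
      * intros w _ Hw; symmetry; apply Hq2, (Hnear z w Hne Hw).
      * apply continuous_on_strip_mult; [exact (Hf z Hz)|].
        apply jet_continuous, Jinv, Hne.
  - intros n z Hz; destruct (Ceq_dec z half) as [->|Hne]; [apply Jq|].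
    apply (jet_ext n (fun w => f (z + w) * / (z + w - half))%C _ _ (Hpos z Hne)).
    + intros w Hw; symmetry; apply Hq2, (Hnear z _ Hne).
      replace (z + w - z)%C with w by ring; exact Hw.
    + apply jet_mult; [apply Jf, Hz|apply Jinv, Hne].
Qed.

(** * The interpolation couple (c_0, l_1) *)

(** On [Re z = 0] the bound is that of [l_infty]: null sequences are not
    required, so that extremal functions, whose moduli are constant on that
    line, belong to the class. *)
Definition c0_l1_bounded (M : R) (f : nat -> C -> C) : Prop :=
  (forall k, holo_strip (f k)) /\
  (forall k t, Cmod (f k (0, t)) <= M) /\
  (forall t n, lsum (fun k => Cmod (f k (1, t))) (seq 0 n) <= M).

Lemma Cmod_exponential_0 (u t : R) : 0 < u ->
  Cmod (cexp (RtoC (2 * ln u) * ((0, t) - half))%C) = / u.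
Proof.
  intro Hu; rewrite Cmod_cexp, Re_half_exponent; simpl.
  replace (2 * ln u * (0 - 1 / 2)) with (- ln u) by field.
  rewrite exp_Ropp, exp_ln by exact Hu; reflexivity.
Qed.

Lemma Cmod_exponential_1 (u t : R) : 0 < u ->
  Cmod (cexp (RtoC (2 * ln u) * ((1, t) - half))%C) = u.
Proof.
  intro Hu; rewrite Cmod_cexp, Re_half_exponent; simpl.
  replace (2 * ln u * (1 - 1 / 2)) with (ln u) by field.
  apply exp_ln, Hu.
Qed.

(** Three lines: the pairing of [f] with the function interpolating between the
    norming functionals of [f (1/2)] for [l_infty], [l_2] and [l_1] is bounded
    by [M] on the boundary of the strip, and equals the [l_2]-norm of
    [f (1/2)] at [1/2]. *)
Lemma half_l2_bound M f n : c0_l1_bounded M f ->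
  lsum (fun k => Cmod (f k half) ^ 2) (seq 0 n) <= M ^ 2.
Proof.
  intros (Hh & Hf0 & Hf1).
  set (y := fun k => f k half); set (l := seq 0 n).
  change (lsum (fun k => Cmod (y k) ^ 2) l <= M ^ 2).
  set (S := lsum (fun k => Cmod (y k) ^ 2) l).
  assert (HM : 0 <= M) by (eapply Rle_trans; [apply Cmod_ge_0|apply (Hf0 0%nat 0)]).
  assert (HS : 0 <= S) by (apply lsum_nonneg; intros; apply pow2_ge_0).
  destruct (Rle_lt_or_eq_dec 0 S HS) as [HS'|<-]; [|apply pow2_ge_0].
  set (N := sqrt S).
  assert (HN : 0 < N) by (apply sqrt_lt_R0, HS').
  assert (HNS : N ^ 2 = S) by (apply pow2_sqrt, HS).
  set (h := fun k z => (Cconj (y k) * RtoC (/ N)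
              * cexp (RtoC (2 * ln (N / Cmod (y k))) * (z - half)))%C).
  set (g := fun z => csum (fun k => f k z * h k z)%C l).
  assert (Hg : holo_strip g).
  { apply holo_strip_csum; intros k _; apply holo_strip_mult; [apply Hh|].
    apply holo_strip_scal, holo_strip_cexp. }
  assert (Hh0 : forall k t, Cmod (h k (0, t)) = Cmod (y k) ^ 2 / S).
  { intros k t; unfold h; rewrite !Cmod_mult, Cmod_conj, Cmod_R.
    rewrite Rabs_pos_eq by (apply Rlt_le, Rinv_0_lt_compat, HN).
    destruct (Req_dec (Cmod (y k)) 0) as [E|E]; [rewrite E; unfold Rdiv; ring|].
    assert (E' : 0 < Cmod (y k)) by (assert (A := Cmod_ge_0 (y k)); lra).
    rewrite Cmod_exponential_0 by (apply Rdiv_lt_0_compat; assumption).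
    rewrite <- HNS; field; lra. }
  assert (Hh1 : forall k t, Cmod (h k (1, t)) <= 1).
  { intros k t; unfold h; rewrite !Cmod_mult, Cmod_conj, Cmod_R.
    rewrite Rabs_pos_eq by (apply Rlt_le, Rinv_0_lt_compat, HN).
    destruct (Req_dec (Cmod (y k)) 0) as [E|E]; [rewrite E; lra|].
    assert (E' : 0 < Cmod (y k)) by (assert (A := Cmod_ge_0 (y k)); lra).
    rewrite Cmod_exponential_1 by (apply Rdiv_lt_0_compat; assumption).
    right; field; lra. }
  assert (Hghalf : g half = RtoC N).
  { unfold g.
    rewrite (csum_ext _ (fun k => RtoC (/ N * Cmod (y k) ^ 2))).
    - rewrite csum_RtoC, lsum_scal; fold S; rewrite <- HNS.
      apply f_equal; field; lra.
    - intros k _; unfold h; fold (y k).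
      replace (half - half)%C with (RtoC 0) by ring; rewrite Cmult_0_r, cexp_0.
      rewrite RtoC_mult, Cmod2_conj; ring. }
  assert (HNM : N <= M).
  { destruct Hg as ([B HB] & Hc & Hj).
    assert (Hmax := strip_max_principle g B M HB Hc (Hj 3%nat)).
    rewrite Hghalf, Cmod_R, (Rabs_pos_eq N) in Hmax by lra.
    apply Hmax; intro t; (eapply Rle_trans; [apply csum_Cmod|]).
    - apply Rle_trans with (lsum (fun k => M / S * Cmod (y k) ^ 2) l).
      + apply lsum_le; intros k _; rewrite Cmod_mult, Hh0.
        replace (M / S * Cmod (y k) ^ 2) with (M * (Cmod (y k) ^ 2 / S))
          by (field; lra).
        apply Rmult_le_compat_r; [|apply Hf0].
        apply Rmult_le_pos; [apply pow2_ge_0|apply Rlt_le, Rinv_0_lt_compat, HS'].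
      + rewrite lsum_scal; fold S; right; field; lra.
    - eapply Rle_trans; [|apply (Hf1 t n)].
      apply lsum_le; intros k _; rewrite Cmod_mult.
      rewrite <- (Rmult_1_r (Cmod (f k (1, t)))) at 2.
      apply Rmult_le_compat_l; [apply Cmod_ge_0|apply Hh1]. }
  rewrite <- HNS; apply pow_incr; lra.
Qed.

Lemma c0_l1_bounded_minus M K f g : c0_l1_bounded M f -> c0_l1_bounded K g ->
  c0_l1_bounded (M + K) (fun k z => f k z - g k z)%C.
Proof.
  intros (Hf & Hf0 & Hf1) (Hg & Hg0 & Hg1).
  assert (T : forall a b : C, Cmod (a - b)%C <= Cmod a + Cmod b).
  { intros a b; rewrite <- (Cmod_opp b); apply Cmod_triangle. }
  split; [|split].
  - intro k; apply holo_strip_minus; auto.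
  - intros k t; eapply Rle_trans; [apply T|]; apply Rplus_le_compat; auto.
  - intros t n; eapply Rle_trans; [apply lsum_le; intros; apply T|].
    rewrite lsum_plus; apply Rplus_le_compat; auto.
Qed.

Lemma Cmod_minus_half_ge (z : C) : Re z = 0 \/ Re z = 1 ->
  1 / 2 <= Cmod (z - half)%C.
Proof.
  intro H; eapply Rle_trans; [|apply re_le_Cmod].
  destruct z as [x y]; simpl in *.
  destruct H as [-> | ->]; unfold Rabs; destruct (Rcase_abs _); lra.
Qed.

(** Comparison with the extremal function [y_k * exp (lam_k (z - 1/2))],
    [lam_k = 2 log (|y_k| / |y|)], whose derivative at [1/2] is twice the
    Kalton-Peck map: the difference vanishes at [1/2], so it can be divided by
    [z - 1/2] with a loss of a factor [2] on the boundary, and the value of the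
    quotient at [1/2] is the derivative of the difference. *)
Lemma half_derivative_bound M f (x y : omega) : c0_l1_bounded M f ->
  (forall k, f k half = y k) ->
  (forall k, is_derive (K := C_AbsRing) (V := C_NormedModule) (f k) half
               (RtoC 2 * x k)%C) ->
  carrier Z2 (x, y) /\ nrm Z2 (x, y) <= 3 * M.
Proof.
  intros Hf Hy Hx.
  assert (HM : 0 <= M).
  { eapply Rle_trans; [apply Cmod_ge_0|apply (proj1 (proj2 Hf) 0%nat 0)]. }
  assert (Hy2 : ell2 y /\ ell2_norm y <= M).
  { apply ell2_bounded; [exact HM|]; intro n.
    rewrite (lsum_ext _ (fun k => Cmod (f k half) ^ 2))
      by (intros; rewrite Hy; reflexivity).
    apply half_l2_bound, Hf. }
  destruct Hy2 as [Hy2 HyM].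
  assert (HN0 := ell2_norm_nonneg y).
  set (N := ell2_norm y) in *.
  set (lam := fun k => 2 * ln (Cmod (y k) / N)).
  set (b := fun k z => (y k * cexp (RtoC (lam k) * (z - half)))%C).
  assert (HN : forall k, Cmod (y k) <> 0 -> 0 < Cmod (y k) /\ 0 < N).
  { intros k E; assert (A := Cmod_ge_0 (y k)).
    assert (B := ell2_norm_coord y k Hy2); fold N in B; lra. }
  assert (Hb : c0_l1_bounded M b).
  { split; [|split].
    - intro k; apply holo_strip_scal, holo_strip_cexp.
    - intros k t; unfold b; rewrite Cmod_mult.
      destruct (Req_dec (Cmod (y k)) 0) as [E|E]; [rewrite E; lra|].
      destruct (HN k E) as [E1 E2].
      unfold lam; rewrite Cmod_exponential_0 by (apply Rdiv_lt_0_compat; assumption).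
      apply Rle_trans with N; [right; field; lra|exact HyM].
    - intros t n.
      apply Rle_trans with (lsum (fun k => / N * Cmod (y k) ^ 2) (seq 0 n)).
      + apply lsum_le; intros k _; unfold b; rewrite Cmod_mult.
        destruct (Req_dec (Cmod (y k)) 0) as [E|E]; [rewrite E; lra|].
        destruct (HN k E) as [E1 E2].
        unfold lam; rewrite Cmod_exponential_1
          by (apply Rdiv_lt_0_compat; assumption).
        right; field; lra.
      + rewrite lsum_scal.
        assert (A := lsum_le_ell2 y n Hy2); fold N in A.
        destruct (Req_dec N 0) as [E|E].
        * assert (0 <= lsum (fun j => Cmod (y j) ^ 2) (seq 0 n))
            by (apply lsum_nonneg; intros; apply pow2_ge_0).
          replace (lsum (fun j => Cmod (y j) ^ 2) (seq 0 n)) with 0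
            by (rewrite E in A; lra); lra.
        * apply Rle_trans with (/ N * N ^ 2).
          -- apply Rmult_le_compat_l; [|exact A].
             apply Rlt_le, Rinv_0_lt_compat; lra.
          -- apply Rle_trans with N; [right; field; exact E|exact HyM]. }
  assert (Hd := c0_l1_bounded_minus M M f b Hf Hb).
  set (d := fun k z => (f k z - b k z)%C) in Hd.
  assert (Hd0 : forall k, d k half = RtoC 0).
  { intro k; unfold d, b; rewrite Hy.
    replace (half - half)%C with (RtoC 0) by ring.
    rewrite Cmult_0_r, cexp_0; ring. }
  set (Q := fun k => constructive_indefinite_description _
              (holo_strip_divide (d k) (proj1 Hd k) (Hd0 k))).
  set (q := fun k => proj1_sig (Q k)).
  assert (Hq : forall k, holo_strip (q k) /\
    (forall z, z <> half -> q k z = (d k z * / (z - half))%C) /\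
    is_derive (K := C_AbsRing) (V := C_NormedModule) (d k) half (q k half))
    by (intro k; exact (proj2_sig (Q k))).
  assert (Hqle : forall k z, Re z = 0 \/ Re z = 1 ->
    Cmod (q k z) <= 2 * Cmod (d k z)).
  { intros k z Hz; assert (A := Cmod_minus_half_ge z Hz).
    assert (Hnz : (z - half)%C <> RtoC 0) by (apply Cmod_gt_0; lra).
    rewrite (proj1 (proj2 (Hq k))).
    - rewrite Cmod_mult, Cmod_inv by exact Hnz.
      rewrite Rmult_comm; apply Rmult_le_compat_r; [apply Cmod_ge_0|].
      apply Rle_trans with (/ (1 / 2)); [apply Rinv_le_contravar; lra|lra].
    - intros ->; apply Hnz; ring. }
  assert (Hqb : c0_l1_bounded (4 * M) q).
  { assert (Hd' := Hd); destruct Hd' as (_ & Hd1 & Hd2); split; [|split].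
    - intro k; apply Hq.
    - intros k t; eapply Rle_trans; [apply Hqle; left; reflexivity|].
      specialize (Hd1 k t); fold (d k (0, t)) in Hd1; lra.
    - intros t n; eapply Rle_trans.
      + apply lsum_le; intros k _; apply Hqle; right; reflexivity.
      + rewrite lsum_scal; specialize (Hd2 t n); lra. }
  assert (Hqhalf : forall k, q k half = (RtoC 2 * (x k - Omega y k))%C).
  { intro k; apply (is_derive_C_unique (d k) half); [apply Hq|].
    assert (D := is_derive_minus (K := C_AbsRing) (V := C_NormedModule)
      (f k) (b k) half _ _ (Hx k)
      (is_derive_C_scal (y k) _ half _
         (cexp_is_derive (RtoC (lam k)) half))).
    replace (RtoC 2 * (x k - Omega y k))%C
      with (RtoC 2 * x k - y k * RtoC (lam k))%C; [exact D|].
    unfold lam, Omega; fold N; rewrite RtoC_mult; ring. }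
  assert (Hdiff : ell2 (minus x (Omega y)) /\ ell2_norm (minus x (Omega y)) <= 2 * M).
  { apply ell2_bounded; [lra|]; intro n.
    assert (A := half_l2_bound (4 * M) q n Hqb).
    rewrite (lsum_ext _ (fun k => 4 * Cmod (minus x (Omega y) k) ^ 2)) in A.
    - rewrite lsum_scal in A; nra.
    - intros k _; rewrite Hqhalf, Cmod_mult, Cmod_R, Rabs_pos_eq by lra.
      change (minus x (Omega y) k) with (x k - Omega y k)%C; ring. }
  split; [split; [exact Hy2|exact (proj1 Hdiff)]|].
  change (ell2_norm (minus x (Omega y)) + N <= 3 * M); lra.
Qed.

(** * Extremal functions with values in c_0 and l_1 *)

Definition tends_to_0 (a : nat -> R) : Prop :=
  forall e, 0 < e -> exists N, forall k, (N <= k)%nat -> a k < e.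

(** A convergent series is divided by the square root of its tails: the
    quotients are at most twice the differences of these square roots, so that
    they still sum.  The weight is the fourth root of the normalized tails.
    Adding a geometric series keeps the tails positive. *)
Lemma slow_weight (s : nat -> R) :
  (forall k, 0 <= s k) -> ex_series s -> Series s <= 1 ->
  exists a : nat -> R, (forall k, 0 < a k <= 1) /\ tends_to_0 a /\
    forall n, lsum (fun k => s k / a k ^ 2) (seq 0 n) <= 4.
Proof.
  intros Hs Hex Hle.
  set (p := fun k => s k + 1 / 2 * (1 / 2) ^ k).
  assert (Hp : forall k, 0 < p k).
  { intro k; specialize (Hs k).
    assert (0 < (1 / 2) ^ k) by (apply pow_lt; lra); unfold p; lra. }
  assert (Hps : is_series p (Series s + 1)).
  { replace 1 with (1 / 2 * / (1 - 1 / 2)) at 1 by field.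
    apply (is_series_plus (K := R_AbsRing) (V := R_NormedModule)).
    - apply Series_correct, Hex.
    - apply (is_series_scal (K := R_AbsRing) (V := R_NormedModule) (1 / 2)).
      apply is_series_geom; rewrite Rabs_pos_eq; lra. }
  set (tau := fun k => (Series s + 1 - lsum p (seq 0 k)) / 2).
  assert (Hstep : forall k, p k = 2 * (tau k - tau (S k))).
  { intro k; unfold tau; rewrite lsum_seq_S; field. }
  assert (Hlim : forall e, 0 < e -> exists N, forall k, (N <= k)%nat -> tau k < e).
  { intros e He; apply is_series_lsum, is_lim_seq_spec in Hps.
    destruct (Hps (mkposreal e He)) as [N HN]; exists N; intros k Hk.
    specialize (HN k Hk); simpl in HN; apply Rabs_def2 in HN; unfold tau; lra. }
  assert (Htau0 : forall k, 0 <= tau k).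
  { intro k; unfold tau.
    assert (A := lsum_le_Series p k (fun j => Rlt_le _ _ (Hp j))
                   (ex_intro _ _ Hps)).
    rewrite (is_series_unique _ _ Hps) in A; lra. }
  assert (Htau : forall k, 0 < tau k).
  { intro k; assert (A := Hstep k); assert (B := Htau0 (S k)).
    assert (D := Hp k); lra. }
  assert (Htau1 : forall k, tau k <= 1).
  { intro k; unfold tau.
    assert (0 <= lsum p (seq 0 k)) by (apply lsum_nonneg; intros; apply Rlt_le, Hp).
    lra. }
  exists (fun k => sqrt (sqrt (tau k))); split; [|split].
  - intro k; split; [apply sqrt_lt_R0, sqrt_lt_R0, Htau|].
    rewrite <- sqrt_1; apply sqrt_le_1_alt; rewrite <- sqrt_1.
    apply sqrt_le_1_alt, Htau1.
  - intros e He; destruct (Hlim (e ^ 4)) as [N HN]; [apply pow_lt, He|].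
    exists N; intros k Hk.
    rewrite <- (sqrt_pow2 e) by lra; apply sqrt_lt_1_alt; split; [apply sqrt_pos|].
    rewrite <- (sqrt_pow2 (e ^ 2)) by (apply pow2_ge_0).
    apply sqrt_lt_1_alt; split; [apply Htau0|].
    replace ((e ^ 2) ^ 2) with (e ^ 4) by ring; apply HN, Hk.
  - intro n.
    apply Rle_trans with (4 * (sqrt (tau 0%nat) - sqrt (tau n))).
    + induction n as [|n IH].
      * unfold lsum; simpl; lra.
      * rewrite lsum_seq_S, pow2_sqrt by apply sqrt_pos.
        assert (Hn : s n / sqrt (tau n) <= 4 * (sqrt (tau n) - sqrt (tau (S n)))).
        { assert (A := sqrt_lt_R0 _ (Htau n)).
          apply Rmult_le_reg_r with (sqrt (tau n)); [exact A|].
          unfold Rdiv; rewrite Rmult_assoc, Rinv_l, Rmult_1_r by lra.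
          apply Rle_trans with (p n).
          - unfold p; assert (0 < (1 / 2) ^ n) by (apply pow_lt; lra); lra.
          - rewrite Hstep.
            assert (E1 := sqrt_sqrt _ (Htau0 n)).
            assert (E2 := sqrt_sqrt _ (Htau0 (S n))).
            assert (A' := sqrt_pos (tau (S n))).
            assert (Hmono : sqrt (tau (S n)) <= sqrt (tau n)).
            { apply sqrt_le_1_alt; assert (D := Hstep n); assert (G := Hp n); lra. }
            nra. }
        lra.
    + assert (A := sqrt_pos (tau n)).
      assert (B : sqrt (tau 0%nat) <= 1)
        by (rewrite <- sqrt_1; apply sqrt_le_1_alt, Htau1).
      lra.
Qed.

Lemma neg_ln_le_inv a : 0 < a <= 1 -> Rabs (ln a) <= / a.
Proof.
  intros [Ha Ha1].
  assert (Hln : ln a <= 0) by (rewrite <- ln_1; apply ln_le; lra).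
  rewrite Rabs_left1 by exact Hln; rewrite <- ln_Rinv by exact Ha.
  assert (Hi := Rinv_0_lt_compat a Ha).
  assert (A := exp_ineq1_le (ln (/ a))).
  rewrite exp_ln in A by exact Hi; lra.
Qed.

(** The extremal function of [half_derivative_bound] does not take its values
    in [c_0] on the line [Re z = 0], where its moduli are constant.  Replacing
    [|y_k|] by [|y_k| / a_k] in the exponents, for a weight [a] tending to [0]
    slowly, repairs this.  The derivative at [1/2] changes by
    [2 y_k log a_k], an element of [l_2] because [|log a| <= 1 / a] and [y / a]
    is still square summable. *)
Lemma extremal_function (y : omega) : ell2 y ->
  exists (lam A d : nat -> R),
    (forall k t, Cmod (y k * cexp (RtoC (lam k) * ((0, t) - half)))%C <= A k) /\
    (forall k, A k <= ell2_norm y) /\ tends_to_0 A /\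
    (forall k t, Cmod (y k * cexp (RtoC (lam k) * ((1, t) - half)))%C <= d k) /\
    (forall n, lsum d (seq 0 n) <= 4 * ell2_norm y) /\
    (forall n, lsum (fun k =>
        Cmod (y k * RtoC (lam k) - RtoC 2 * Omega y k)%C ^ 2) (seq 0 n)
      <= (4 * ell2_norm y) ^ 2).
Proof.
  intro Hy; set (N := ell2_norm y).
  assert (HN0 : 0 <= N) by apply ell2_norm_nonneg.
  assert (HN : forall k, Cmod (y k) <> 0 -> 0 < Cmod (y k) /\ 0 < N).
  { intros k E; assert (A := Cmod_ge_0 (y k)).
    assert (B := ell2_norm_coord y k Hy); fold N in B; lra. }
  set (s := fun k => / N ^ 2 * Cmod (y k) ^ 2).
  assert (HsN : forall k, Cmod (y k) ^ 2 = N ^ 2 * s k).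
  { intro k; unfold s; destruct (Req_dec (Cmod (y k)) 0) as [E|E].
    - rewrite E; ring.
    - destruct (HN k E); field; lra. }
  assert (Hs0 : forall k, 0 <= s k).
  { intro k; destruct (Req_dec (Cmod (y k)) 0) as [E|E].
    - unfold s; rewrite E; lra.
    - destruct (HN k E) as [E1 E2]; unfold s.
      apply Rmult_le_pos; [|apply pow2_ge_0].
      apply Rlt_le, Rinv_0_lt_compat, pow_lt, E2. }
  destruct (ex_series_bounded s 1 Hs0) as [Hs1 Hs2].
  { intro n; assert (A := lsum_le_ell2 y n Hy); fold N in A.
    unfold s; rewrite lsum_scal.
    assert (B : 0 <= lsum (fun j => Cmod (y j) ^ 2) (seq 0 n))
      by (apply lsum_nonneg; intros; apply pow2_ge_0).
    destruct (Req_dec N 0) as [E|E].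
    - replace (lsum (fun j => Cmod (y j) ^ 2) (seq 0 n)) with 0
        by (rewrite E in A; lra); lra.
    - assert (P : 0 < N ^ 2) by (apply pow_lt; lra).
      apply Rle_trans with (/ N ^ 2 * N ^ 2).
      + apply Rmult_le_compat_l; [|exact A].
        apply Rlt_le, Rinv_0_lt_compat, P.
      + right; field; exact E. }
  destruct (slow_weight s Hs0 Hs1 Hs2) as (a & Ha & Ha0 & Hsum).
  exists (fun k => 2 * ln (Cmod (y k) / (a k * N))), (fun k => N * a k),
    (fun k => N * (s k / a k ^ 2)).
  assert (Hd0 : forall k, 0 <= s k / a k ^ 2).
  { intro k; apply Rmult_le_pos; [apply Hs0|].
    apply Rlt_le, Rinv_0_lt_compat, pow_lt, Ha. }
  split; [|split; [|split; [|split; [|split]]]].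
  - intros k t; rewrite Cmod_mult; destruct (Ha k) as [Ha1 Ha2].
    destruct (Req_dec (Cmod (y k)) 0) as [E|E].
    + rewrite E, Rmult_0_l; apply Rmult_le_pos; lra.
    + destruct (HN k E) as [E1 E2].
      rewrite Cmod_exponential_0
        by (apply Rdiv_lt_0_compat; [|apply Rmult_lt_0_compat]; assumption).
      right; field; lra.
  - intro k; destruct (Ha k); nra.
  - intros e He.
    assert (HeN : 0 < e / (N + 1)) by (apply Rdiv_lt_0_compat; lra).
    destruct (Ha0 _ HeN) as [K HK]; exists K; intros k Hk.
    specialize (HK k Hk); destruct (Ha k) as [Ha1 Ha2].
    assert (e / (N + 1) * (N + 1) = e) by (field; lra); nra.
  - intros k t; rewrite Cmod_mult; destruct (Ha k) as [Ha1 Ha2].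
    destruct (Req_dec (Cmod (y k)) 0) as [E|E].
    + rewrite E, Rmult_0_l; apply Rmult_le_pos; auto.
    + destruct (HN k E) as [E1 E2].
      rewrite Cmod_exponential_1
        by (apply Rdiv_lt_0_compat; [|apply Rmult_lt_0_compat]; assumption).
      replace (Cmod (y k) * (Cmod (y k) / (a k * N)))
        with (N * (s k / a k ^ 2) * a k)
        by (unfold s; field; lra).
      rewrite <- (Rmult_1_r (N * (s k / a k ^ 2))) at 2.
      apply Rmult_le_compat_l; [|exact Ha2].
      apply Rmult_le_pos; auto.
  - intro n; rewrite lsum_scal; specialize (Hsum n); nra.
  - intro n.
    apply Rle_trans with (lsum (fun k => 4 * N ^ 2 * (s k / a k ^ 2)) (seq 0 n)).
    + apply lsum_le; intros k _; destruct (Ha k) as [Ha1 Ha2].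
      destruct (Req_dec (Cmod (y k)) 0) as [E|E].
      * unfold Omega; fold N; apply Cmod_eq_0 in E; rewrite E, !Cmult_0_l.
        replace (RtoC 0 - RtoC 2 * RtoC 0)%C with (RtoC 0) by ring.
        rewrite Cmod_0, pow_ne_zero by discriminate.
        apply Rmult_le_pos; [nra|apply Hd0].
      * destruct (HN k E) as [E1 E2].
        replace (Cmod (y k) / (a k * N)) with (Cmod (y k) / N * / a k)
          by (field; lra).
        rewrite ln_mult, ln_Rinv
          by (try apply Rdiv_lt_0_compat; try apply Rinv_0_lt_compat; assumption).
        unfold Omega; fold N.
        replace (y k * RtoC (2 * (ln (Cmod (y k) / N) + - ln (a k)))
                 - RtoC 2 * (y k * RtoC (ln (Cmod (y k) / N))))%C
          with (- (RtoC 2 * (y k * RtoC (ln (a k)))))%C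
          by (rewrite RtoC_mult, RtoC_plus, RtoC_opp; ring).
        rewrite Cmod_opp, !Cmod_mult, !Cmod_R, (Rabs_pos_eq 2) by lra.
        assert (L := neg_ln_le_inv (a k) (Ha k)).
        assert (L0 := Rabs_pos (ln (a k))).
        assert (L2 : Rabs (ln (a k)) ^ 2 <= (/ a k) ^ 2) by (apply pow_incr; lra).
        replace (4 * N ^ 2 * (s k / a k ^ 2))
          with (4 * Cmod (y k) ^ 2 * (/ a k) ^ 2)
          by (rewrite HsN; field; lra).
        replace ((2 * (Cmod (y k) * Rabs (ln (a k)))) ^ 2)
          with (4 * Cmod (y k) ^ 2 * Rabs (ln (a k)) ^ 2) by ring.
        apply Rmult_le_compat_l; [|exact L2].
        assert (P := pow2_ge_0 (Cmod (y k))); lra.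
    + rewrite lsum_scal; specialize (Hsum n).
      assert (0 <= N ^ 2) by apply pow2_ge_0; nra.
Qed.

(** The domination by a null sequence [A] and a summable sequence [d], uniform
    in the ordinate, provides norm continuity on both boundary lines. *)
Definition c0_l1_dominated (M : R) (c : nat -> C -> C) : Prop :=
  (forall k, holo_strip (c k)) /\ (forall k z, analytic_at (c k) z) /\
  exists A d : nat -> R,
    (forall k t, Cmod (c k (0, t)) <= A k) /\
    (forall k, A k <= M) /\ tends_to_0 A /\
    (forall k t, Cmod (c k (1, t)) <= d k) /\
    (forall n, lsum d (seq 0 n) <= M).

Lemma c0_l1_dominated_bounded M c : c0_l1_dominated M c -> c0_l1_bounded M c.
Proof.
  intros (Hh & _ & A & d & HA & HAM & _ & Hd & HdM); split; [exact Hh|split].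
  - intros k t; eapply Rle_trans; [apply HA|apply HAM].
  - intros t n; eapply Rle_trans; [|apply (HdM n)].
    apply lsum_le; intros; apply Hd.
Qed.

(** The extremal function of [y] has the derivative [2 Omega y] at [1/2], up to
    an element of [l_2].  What is missing from [2 x] is the value [v] of
    another extremal function, and the factor [exp (z - 1/2) - 1] turns a value
    at [1/2] into a derivative. *)
Lemma Z2_extension (x y : omega) : carrier Z2 (x, y) ->
  exists c, c0_l1_dominated (52 * nrm Z2 (x, y)) c /\
    (forall k, c k half = y k) /\
    (forall k, is_derive (K := C_AbsRing) (V := C_NormedModule) (c k) half
                 (RtoC 2 * x k)%C).
Proof.
  intros [Hy Hxy]; simpl in Hy, Hxy.
  set (N := ell2_norm y); set (D := ell2_norm (minus x (Omega y))).
  assert (HN : 0 <= N) by apply ell2_norm_nonneg.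
  assert (HD : 0 <= D) by apply ell2_norm_nonneg.
  change (nrm Z2 (x, y)) with (D + N).
  destruct (extremal_function y Hy)
    as (lam & A & d & HA & HAN & HA0 & Hd & HdN & Hlam).
  fold N in HAN, HdN, Hlam.
  set (v := fun k => (RtoC 2 * x k - y k * RtoC (lam k))%C : C).
  assert (Hv : ell2 v /\ ell2_norm v <= 2 * D + 4 * N).
  { apply ell2_bounded; [lra|]; intro n.
    eapply Rle_trans;
      [|apply (lsum_Minkowski (fun k => 2 * Cmod (minus x (Omega y) k))
           (fun k => Cmod (y k * RtoC (lam k) - RtoC 2 * Omega y k)%C)); try lra;
        [|apply Hlam]].
    - apply lsum_le; intros k _; apply pow_incr; split; [apply Cmod_ge_0|].
      rewrite <- (Rabs_pos_eq 2) at 1 by lra; rewrite <- Cmod_R, <- Cmod_mult.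
      rewrite <- (Cmod_opp (y k * RtoC (lam k) - _)).
      eapply Rle_trans; [|apply Cmod_triangle]; right; f_equal.
      change (minus x (Omega y) k) with (x k - Omega y k)%C; unfold v; ring.
    - rewrite (lsum_ext _ (fun k => 4 * Cmod (minus x (Omega y) k) ^ 2))
        by (intros; ring).
      rewrite lsum_scal.
      assert (B := lsum_le_ell2 (minus x (Omega y)) n Hxy); fold D in B; nra. }
  destruct Hv as [Hv HvN]; set (V := ell2_norm v) in *.
  assert (HV : 0 <= V) by apply ell2_norm_nonneg.
  destruct (extremal_function v Hv)
    as (mu & A' & d' & HA' & HAN' & HA0' & Hd' & HdN' & _).
  fold V in HAN', HdN'.
  set (e := fun (a : C) (r : R) z => (a * cexp (RtoC r * (z - half)))%C).
  set (c := fun k z => (e (y k) (lam k) z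
              + (e (v k) (1 + mu k)%R z - e (v k) (mu k) z))%C).
  assert (He : forall a r, holo_strip (e a r))
    by (intros; apply holo_strip_scal, holo_strip_cexp).
  assert (Hea : forall a r z, analytic_at (e a r) z)
    by (intros; apply analytic_at_scal, cexp_analytic).
  assert (Hed : forall a r, is_derive (K := C_AbsRing) (V := C_NormedModule)
                  (e a r) half (a * RtoC r)%C)
    by (intros; apply is_derive_C_scal, cexp_is_derive).
  assert (Hehalf : forall a r, e a r half = a).
  { intros a r; unfold e; replace (half - half)%C with (RtoC 0) by ring.
    rewrite Cmult_0_r, cexp_0; ring. }
  assert (Hshift : forall a r z, Re z <= 1 ->
    Cmod (e a (1 + r)%R z - e a r z)%C <= 3 * Cmod (e a r z)).
  { intros a r z Hz; unfold e.
    replace (RtoC (1 + r) * (z - half))%C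
      with (RtoC 1 * (z - half) + RtoC r * (z - half))%C
      by (rewrite RtoC_plus; ring).
    rewrite cexp_plus.
    replace (a * (cexp (RtoC 1 * (z - half)) * cexp (RtoC r * (z - half)))
             - a * cexp (RtoC r * (z - half)))%C
      with ((cexp (RtoC 1 * (z - half)) + - RtoC 1)
            * (a * cexp (RtoC r * (z - half))))%C by ring.
    rewrite Cmod_mult; apply Rmult_le_compat_r; [apply Cmod_ge_0|].
    eapply Rle_trans; [apply Cmod_triangle|].
    rewrite Cmod_opp, Cmod_1, Cmod_cexp, Re_half_exponent.
    assert (exp (1 * (Re z - 1 / 2)) <= exp (1 / 2)) by (apply exp_le; lra).
    assert (H2 : exp (1 / 2) * exp (1 / 2) <= 3).
    { rewrite <- exp_plus; replace (1 / 2 + 1 / 2) with 1 by field.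
      apply exp_le_3. }
    assert (P := exp_pos (1 / 2)).
    assert (exp (1 / 2) <= 2) by nra; lra. }
  exists c; split; [split; [|split]|split].
  - intro k; apply holo_strip_plus; [|apply holo_strip_minus]; apply He.
  - intros k z; apply analytic_at_plus; [apply Hea|].
    replace (fun w => (e (v k) (1 + mu k)%R w - e (v k) (mu k) w)%C)
      with (fun w => (e (v k) (1 + mu k)%R w + RtoC (-1) * e (v k) (mu k) w)%C)
      by (apply functional_extensionality; intro; ring).
    apply analytic_at_plus; [|apply analytic_at_scal]; apply Hea.
  - exists (fun k => A k + 3 * A' k), (fun k => d k + 3 * d' k).
    split; [|split; [|split; [|split]]].
    + intros k t; eapply Rle_trans; [apply Cmod_triangle|].
      assert (B := Hshift (v k) (mu k) (0, t) Rle_0_1).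
      specialize (HA k t); specialize (HA' k t).
      fold (e (y k) (lam k) (0, t)) in HA; fold (e (v k) (mu k) (0, t)) in HA'.
      lra.
    + intro k; specialize (HAN k); specialize (HAN' k); lra.
    + intros eps Heps.
      destruct (HA0 (eps / 4)) as [K HK]; [lra|].
      destruct (HA0' (eps / 4)) as [K' HK']; [lra|].
      exists (Nat.max K K'); intros k Hk.
      specialize (HK k ltac:(lia)); specialize (HK' k ltac:(lia)); lra.
    + intros k t; eapply Rle_trans; [apply Cmod_triangle|].
      assert (B := Hshift (v k) (mu k) (1, t) (Rle_refl 1)).
      specialize (Hd k t); specialize (Hd' k t).
      fold (e (y k) (lam k) (1, t)) in Hd; fold (e (v k) (mu k) (1, t)) in Hd'.
      lra.
    (* [4 N + 3 * 4 * (2 D + 4 N)] is where the constant 52 is needed *)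
    + intro n; rewrite lsum_plus, lsum_scal.
      specialize (HdN n); specialize (HdN' n); lra.
  - intro k; unfold c; rewrite !Hehalf; ring.
  - intro k.
    assert (Hder := is_derive_plus (K := C_AbsRing) (V := C_NormedModule) _ _ half _ _
      (Hed (y k) (lam k))
      (is_derive_minus (K := C_AbsRing) (V := C_NormedModule) _ _ half _ _
         (Hed (v k) (1 + mu k)%R) (Hed (v k) (mu k)))).
    replace (RtoC 2 * x k)%C
      with (y k * RtoC (lam k) + (v k * RtoC (1 + mu k) - v k * RtoC (mu k)))%C;
      [exact Hder|].
    unfold v; rewrite RtoC_plus; ring.
Qed.

(** * The norms of S^2 and of its dual *)

Lemma real_Lub_Rbar (E : R -> Prop) (K : R) :
  (forall r, E r -> r <= K) -> (exists r, E r) ->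
  Lub_Rbar E = Finite (real (Lub_Rbar E)) /\ real (Lub_Rbar E) <= K /\
  (forall r, E r -> r <= real (Lub_Rbar E)).
Proof.
  intros HK [r0 Hr0].
  destruct (Lub_Rbar_correct E) as [Hub Hlub].
  assert (H : Rbar_le (Lub_Rbar E) K) by (apply Hlub; intros r Hr; apply HK, Hr).
  assert (H0 := Hub r0 Hr0).
  destruct (Lub_Rbar E) as [l| |]; [|destruct H|destruct H0].
  split; [reflexivity|split; [exact H|]]; intros r Hr; exact (Hub r Hr).
Qed.

Definition S2_le (x : omega) (K : R) : Prop :=
  forall A, admissible A -> lsum (fun j => Cmod (x j) ^ 2) A <= K ^ 2.

Lemma admissible_nil : admissible nil.
Proof. split; [constructor|intros j []]. Qed.

Lemma S2_norm_le x K : 0 <= K -> S2_le x K ->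
  S2_norm x = Finite (real (S2_norm x)) /\ 0 <= real (S2_norm x) <= K.
Proof.
  intros HK H.
  destruct (real_Lub_Rbar (fun r => exists A, admissible A /\
    r = sqrt (fold_right Rplus 0 (map (fun j => (Cmod (x j)) ^ 2) A))) K)
    as (H1 & H2 & H3).
  - intros r (A & HA & ->); rewrite <- (sqrt_pow2 K HK).
    apply sqrt_le_1_alt, H, HA.
  - exists (sqrt 0), nil; split; [apply admissible_nil|reflexivity].
  - split; [exact H1|split; [|exact H2]].
    rewrite <- sqrt_0; apply H3; exists nil.
    split; [apply admissible_nil|reflexivity].
Qed.

Lemma S2_norm_finite x r : S2_norm x = Finite r -> 0 <= r /\ S2_le x r.
Proof.
  intro H.
  assert (Hub : forall A, admissible A ->
            sqrt (lsum (fun j => Cmod (x j) ^ 2) A) <= r).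
  { intros A HA.
    destruct (Lub_Rbar_correct (fun r => exists A, admissible A /\
      r = sqrt (fold_right Rplus 0 (map (fun j => (Cmod (x j)) ^ 2) A))))
      as [Hub _].
    fold (S2_norm x) in Hub; rewrite H in Hub.
    apply (Hub _); exists A; split; [exact HA|reflexivity]. }
  split.
  - eapply Rle_trans; [apply sqrt_pos|apply (Hub nil admissible_nil)].
  - intros A HA.
    rewrite <- (pow2_sqrt (lsum _ A))
      by (apply lsum_nonneg; intros; apply pow2_ge_0).
    apply pow_incr; split; [apply sqrt_pos|apply Hub, HA].
Qed.

Lemma S2_norm_lt x e : Rbar_lt (S2_norm x) (Finite e) -> 0 < e /\ S2_le x e.
Proof.
  intro H.
  assert (H0 : Rbar_le 0 (S2_norm x)).
  { destruct (Lub_Rbar_correct (fun r => exists A, admissible A /\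
      r = sqrt (fold_right Rplus 0 (map (fun j => (Cmod (x j)) ^ 2) A))))
      as [Hub _].
    rewrite <- sqrt_0; apply (Hub _); exists nil.
    split; [apply admissible_nil|reflexivity]. }
  destruct (S2_norm x) as [r| |] eqn:E; [|destruct H|destruct H0].
  simpl in H, H0; destruct (S2_norm_finite x r E) as [Hr Hle].
  split; [lra|]; intros A HA; eapply Rle_trans; [apply Hle, HA|].
  apply pow_incr; lra.
Qed.

Lemma S2_norm_lt_of_le x (K e : R) : 0 <= K -> S2_le x K -> K < e ->
  Rbar_lt (S2_norm x) (Finite e).
Proof.
  intros HK Hx He; destruct (S2_norm_le x K HK Hx) as [E H].
  rewrite E; simpl; lra.
Qed.

Lemma S2_le_plus x y K L : 0 <= K -> 0 <= L -> S2_le x K -> S2_le y L ->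
  S2_le (fun j => x j + y j)%C (K + L).
Proof.
  intros HK HL Hx Hy A HA.
  eapply Rle_trans;
    [|apply (lsum_Minkowski (fun j => Cmod (x j)) (fun j => Cmod (y j)));
      [exact HK|exact HL|apply Hx, HA|apply Hy, HA]].
  apply lsum_le; intros j _; apply pow_incr.
  split; [apply Cmod_ge_0|apply Cmod_triangle].
Qed.

Lemma c00_S2_le y : c00 y -> exists K, 0 <= K /\ S2_le y K.
Proof.
  intros [N HN].
  set (K0 := lsum (fun j => Cmod (y j)) (seq 0 N)).
  assert (HK0 : 0 <= K0) by (apply lsum_nonneg; intros; apply Cmod_ge_0).
  assert (HyK : forall j, Cmod (y j) <= K0).
  { intro j; destruct (Nat.lt_ge_cases j N).
    - apply (lsum_in (fun j => Cmod (y j))); [intros; apply Cmod_ge_0|].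
      apply in_seq; lia.
    - rewrite HN, Cmod_0 by assumption; exact HK0. }
  exists (sqrt (INR N) * K0); split; [apply Rmult_le_pos; [apply sqrt_pos|exact HK0]|].
  intros A [_ HA].
  rewrite Rpow_mult_distr, pow2_sqrt by apply pos_INR.
  destruct (classic (exists j, In j A /\ (j < N)%nat)) as [[j [Hj HjN]]|Hno].
  - eapply Rle_trans; [apply (lsum_le _ (fun _ => K0 ^ 2)); intros; apply pow_incr|].
    + split; [apply Cmod_ge_0|apply HyK].
    + rewrite lsum_const; apply Rmult_le_compat_r; [apply pow2_ge_0|].
      apply le_INR; specialize (HA j Hj); lia.
  - rewrite (lsum_ext _ (fun _ => 0)).
    + rewrite lsum_const, Rmult_0_r.
      apply Rmult_le_pos; [apply pos_INR|apply pow2_ge_0].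
    + intros j Hj; rewrite HN; [rewrite Cmod_0; ring|].
      apply Nat.nlt_ge; intro; apply Hno; exists j; auto.
Qed.

Lemma S2_carrier_norm x : carrier S2 x -> 0 <= nrm S2 x /\ S2_le x (nrm S2 x).
Proof.
  intro Hx; destruct (Hx 1 Rlt_0_1) as (y & Hy & Hxy).
  destruct (c00_S2_le y Hy) as (K & HK & HyK).
  apply S2_norm_lt in Hxy; destruct Hxy as [_ Hxy].
  assert (H := S2_le_plus _ _ _ _ (Rlt_le _ _ Rlt_0_1) HK Hxy HyK).
  assert (H' : S2_le x (1 + K)).
  { intros A HA; rewrite (lsum_ext _ (fun j => Cmod (minus x y j + y j)%C ^ 2)).
    - apply H, HA.
    - intros j _; change (minus x y j) with (x j - y j)%C.
      f_equal; f_equal; ring. }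
  apply S2_norm_finite; change (S2_norm x = Finite (real (S2_norm x))).
  apply (S2_norm_le x (1 + K)); [lra|exact H'].
Qed.

Lemma S2_nrm_le x K : 0 <= K -> S2_le x K -> 0 <= nrm S2 x <= K.
Proof. intros HK H; apply (S2_norm_le x K HK H). Qed.

Lemma c00_carrier x : c00 x -> carrier S2 x.
Proof.
  intros Hx e He; exists x; split; [exact Hx|].
  apply (S2_norm_lt_of_le _ 0); [lra| |exact He].
  intros A _; rewrite (lsum_ext _ (fun _ => 0)).
  - rewrite lsum_const; lra.
  - intros j _; change (minus x x j) with (x j - x j)%C.
    replace (x j - x j)%C with (RtoC 0) by ring; rewrite Cmod_0; ring.
Qed.

Definition dual_le (y : omega) (K : R) : Prop :=
  forall x, carrier S2 x -> exists l, pairing x y l /\ Cmod l <= K * nrm S2 x.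

Lemma dual_nrm_bounds y K : dual_le y K -> 0 <= K ->
  0 <= nrm (dual S2) y <= K /\
  forall x l, carrier S2 x -> nrm S2 x <= 1 -> pairing x y l ->
    Cmod l <= nrm (dual S2) y.
Proof.
  intros Hy HK.
  set (E := fun r => exists x l, carrier S2 x /\ nrm S2 x <= 1 /\ pairing x y l
                       /\ r = Cmod l).
  assert (HE : forall r, E r -> r <= K).
  { intros r (x & l & Hx & Hx1 & Hl & ->).
    destruct (Hy x Hx) as (l' & Hl' & Hle).
    rewrite (is_series_C_unique _ l l' Hl Hl').
    destruct (S2_carrier_norm x Hx); nra. }
  assert (H0 : exists l, E (Cmod l)).
  { assert (Hz : carrier S2 (fun _ => RtoC 0))
      by (apply c00_carrier; exists 0%nat; reflexivity).
    destruct (Hy _ Hz) as (l & Hl & _); exists l, (fun _ => RtoC 0), l.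
    split; [exact Hz|split; [|split; [exact Hl|reflexivity]]].
    apply S2_nrm_le; [lra|]; intros A _.
    rewrite (lsum_ext _ (fun _ => 0)); [rewrite lsum_const; lra|].
    intros; rewrite Cmod_0; ring. }
  destruct H0 as [l0 Hl0].
  destruct (real_Lub_Rbar E K HE (ex_intro _ _ Hl0)) as (_ & H2 & H3).
  split; [split; [|exact H2]|].
  - eapply Rle_trans; [apply Cmod_ge_0|apply (H3 _ Hl0)].
  - intros x l Hx Hx1 Hl; apply H3; exists x, l; auto.
Qed.

Lemma dual_carrier_le y : carrier (dual S2) y -> exists K, 0 <= K /\ dual_le y K.
Proof.
  intros [K HK]; exists (Rabs K); split; [apply Rabs_pos|].
  intros x Hx; destruct (HK x Hx) as (l & Hl & Hle); exists l; split; [exact Hl|].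
  eapply Rle_trans; [exact Hle|]; apply Rmult_le_compat_r.
  - apply (S2_carrier_norm x Hx).
  - apply Rle_abs.
Qed.

(** * Dyadic blocks *)

Definition block (k : nat) : list nat := seq (2 ^ k - 1) (2 ^ k).

Definition block_of (j : nat) : nat := Nat.log2 (S j).

(** The [k]-th unit vector goes to the normalized indicator of the [k]-th
    dyadic block. *)
Definition spread (c : omega) : omega :=
  fun j => (RtoC (/ sqrt (2 ^ block_of j)) * c (block_of j))%C.

(** The transpose of [spread], and a left inverse of it. *)
Definition average (x : omega) : omega :=
  fun k => (RtoC (/ sqrt (2 ^ k)) * csum x (block k))%C.

Lemma in_block j k : In j (block k) -> block_of j = k.
Proof.
  unfold block, block_of; rewrite in_seq; intros [H1 H2].
  assert (2 ^ k <> 0)%nat by (apply Nat.pow_nonzero; discriminate).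
  apply Nat.log2_unique; [lia|]; simpl; lia.
Qed.

Lemma sqrt_pow2_pos k : 0 < sqrt (2 ^ k).
Proof. apply sqrt_lt_R0, pow_lt; lra. Qed.

Lemma INR_pow2 k : INR (2 ^ k) = 2 ^ k.
Proof. rewrite pow_INR; reflexivity. Qed.

Lemma block_admissible k : admissible (block k).
Proof.
  split; [apply seq_NoDup|].
  intros j Hj; unfold block in *; rewrite length_seq; apply in_seq in Hj; lia.
Qed.

Lemma seq_blocks n : seq 0 (2 ^ S n - 1) = seq 0 (2 ^ n - 1) ++ block n.
Proof.
  assert (2 ^ n <> 0)%nat by (apply Nat.pow_nonzero; discriminate).
  replace (2 ^ S n - 1)%nat with ((2 ^ n - 1) + 2 ^ n)%nat by (simpl; lia).
  apply seq_app.
Qed.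

Lemma lsum_blocks f n :
  lsum f (seq 0 (2 ^ n - 1)) = lsum (fun k => lsum f (block k)) (seq 0 n).
Proof.
  induction n as [|n IH]; [reflexivity|].
  rewrite seq_blocks, lsum_app, IH, lsum_seq_S; reflexivity.
Qed.

Lemma csum_blocks f n :
  csum f (seq 0 (2 ^ n - 1)) = csum (fun k => csum f (block k)) (seq 0 n).
Proof.
  induction n as [|n IH]; [reflexivity|].
  rewrite seq_blocks, csum_app, IH, seq_S, csum_app.
  f_equal; unfold csum at 2; simpl; ring.
Qed.

Lemma average_spread c : average (spread c) = c.
Proof.
  apply functional_extensionality; intro k; unfold average.
  rewrite (csum_ext _ (fun _ => RtoC (/ sqrt (2 ^ k)) * c k)%C).
  - rewrite csum_const; unfold block; rewrite length_seq, INR_pow2.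
    transitivity (c k * RtoC (2 ^ k * (/ sqrt (2 ^ k) * / sqrt (2 ^ k))))%C;
      [rewrite !RtoC_mult; ring|].
    assert (A := sqrt_pow2_pos k).
    rewrite <- Rinv_mult, sqrt_sqrt by (apply pow_le; lra).
    rewrite Rinv_r by (apply pow_nonzero; lra); ring.
  - intros j Hj; unfold spread; rewrite (in_block j k Hj); reflexivity.
Qed.

Lemma csum_spread_block c x k :
  csum (fun j => spread c j * x j)%C (block k) = (c k * average x k)%C.
Proof.
  unfold average; rewrite Cmult_assoc, <- csum_scal.
  apply csum_ext; intros j Hj; unfold spread; rewrite (in_block j k Hj); ring.
Qed.

(** Blocks are admissible, so that the Cauchy-Schwarz inequality bounds the
    block sums by the norm of S^2. *)
Lemma block_lsum_le x K k : 0 <= K -> S2_le x K ->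
  / sqrt (2 ^ k) * lsum (fun j => Cmod (x j)) (block k) <= K.
Proof.
  intros HK Hx; assert (A := sqrt_pow2_pos k).
  assert (B := lsum_Cauchy_Schwarz (fun _ => 1) (fun j => Cmod (x j)) (block k)).
  rewrite (lsum_ext (fun j => 1 * Cmod (x j)) (fun j => Cmod (x j)))
    in B by (intros; ring).
  rewrite lsum_const in B; unfold block at 2 in B.
  rewrite length_seq, INR_pow2 in B.
  assert (D := Hx _ (block_admissible k)).
  set (s := lsum (fun j => Cmod (x j)) (block k)) in *.
  assert (E := sqrt_sqrt (2 ^ k) ltac:(apply pow_le; lra)).
  assert (Hs : s <= sqrt (2 ^ k) * K).
  { apply Rsqr_incr_0_var; [|apply Rmult_le_pos; lra]; unfold Rsqr.
    assert (P : 0 < 2 ^ k) by (apply pow_lt; lra).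
    replace (sqrt (2 ^ k) * K * (sqrt (2 ^ k) * K)) with (2 ^ k * K ^ 2)
      by (rewrite <- E at 1; ring).
    nra. }
  apply Rmult_le_reg_l with (sqrt (2 ^ k)); [exact A|].
  rewrite <- Rmult_assoc, Rinv_r, Rmult_1_l by lra; exact Hs.
Qed.

Lemma Cmod_average_le x k : Cmod (average x k)
  <= / sqrt (2 ^ k) * lsum (fun j => Cmod (x j)) (block k).
Proof.
  unfold average; rewrite Cmod_mult, Cmod_R, Rabs_pos_eq
    by (apply Rlt_le, Rinv_0_lt_compat, sqrt_pow2_pos).
  apply Rmult_le_compat_l; [apply Rlt_le, Rinv_0_lt_compat, sqrt_pow2_pos|].
  apply csum_Cmod.
Qed.

(** Upper [c_0] estimate for the normalized blocks: every element [j] of an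
    admissible set [A] lies in a block of more than [|A| / 2] elements, hence
    has a coefficient of square at most [2 K^2 / |A|]. *)
Lemma S2_le_spread c K : (forall k, Cmod (c k) <= K) -> S2_le (spread c) (2 * K).
Proof.
  intros Hc A [_ HA].
  apply Rle_trans with (lsum (fun _ => 2 * K ^ 2 * / INR (length A)) A).
  - apply lsum_le; intros j Hj; unfold spread.
    assert (P : 0 < 2 ^ block_of j) by (apply pow_lt; lra).
    rewrite Cmod_mult, Cmod_R, Rabs_pos_eq, Rpow_mult_distr, pow_inv, pow2_sqrt
      by (try apply Rlt_le; try apply Rinv_0_lt_compat; try apply sqrt_pow2_pos;
          exact P).
    assert (Hlen : (0 < length A)%nat) by (destruct A; [destruct Hj|simpl; lia]).
    assert (HlenR : 0 < INR (length A)) by (apply lt_0_INR, Hlen).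
    assert (Hpow : INR (length A) <= 2 * 2 ^ block_of j).
    { replace (2 * 2 ^ block_of j) with (INR (2 ^ S (block_of j)))
        by (rewrite INR_pow2; reflexivity).
      apply le_INR; specialize (HA j Hj).
      destruct (Nat.log2_spec (S j)) as [_ Hlog]; [lia|].
      fold (block_of j) in Hlog; lia. }
    apply Rle_trans with (/ 2 ^ block_of j * K ^ 2).
    + apply Rmult_le_compat_l; [apply Rlt_le, Rinv_0_lt_compat, P|].
      apply pow_incr; split; [apply Cmod_ge_0|apply Hc].
    + replace (2 * K ^ 2 * / INR (length A))
        with (/ (INR (length A) / 2) * K ^ 2) by (field; lra).
      apply Rmult_le_compat_r; [apply pow2_ge_0|].
      apply Rinv_le_contravar; lra.
  - rewrite lsum_const.
    assert (Q := pow2_ge_0 K).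
    destruct (Req_dec (INR (length A)) 0) as [E|E]; [rewrite E; nra|].
    replace (INR (length A) * (2 * K ^ 2 * / INR (length A)))
      with (2 * K ^ 2) by (field; exact E); nra.
Qed.

Lemma spread_minus c d : minus (spread c) (spread d) = spread (fun k => c k - d k)%C.
Proof.
  apply functional_extensionality; intro j; unfold spread.
  change (RtoC (/ sqrt (2 ^ block_of j)) * c (block_of j)
          - RtoC (/ sqrt (2 ^ block_of j)) * d (block_of j)
          = RtoC (/ sqrt (2 ^ block_of j)) * (c (block_of j) - d (block_of j)))%C.
  ring.
Qed.

Lemma spread_c00 c : c00 c -> c00 (spread c).
Proof.
  intros [N HN]; exists (2 ^ N)%nat; intros j Hj; unfold spread.
  rewrite HN; [ring|]; unfold block_of.
  rewrite <- (Nat.log2_pow2 N) by lia; apply Nat.log2_le_mono; lia.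
Qed.

Lemma spread_carrier c : tends_to_0 (fun k => Cmod (c k)) -> carrier S2 (spread c).
Proof.
  intros Hc e He; destruct (Hc (e / 4)) as [N HN]; [lra|].
  exists (spread (fun k => if (k <? N)%nat then c k else RtoC 0)); split.
  - apply spread_c00; exists N; intros k Hk.
    rewrite (proj2 (Nat.ltb_ge k N) Hk); reflexivity.
  - rewrite spread_minus.
    apply (S2_norm_lt_of_le _ (2 * (e / 4))); [lra| |lra].
    apply S2_le_spread; intro k; destruct (Nat.ltb_spec k N).
    + replace (c k - c k)%C with (RtoC 0) by ring; rewrite Cmod_0; lra.
    + replace (c k - RtoC 0)%C with (c k) by ring; apply Rlt_le, HN; assumption.
Qed.

(** Upper [l_1] estimate in the dual: by [block_lsum_le] each normalized block
    has dual norm at most [1]. *)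
Lemma dual_le_spread c K : (forall n, lsum (fun k => Cmod (c k)) (seq 0 n) <= K) ->
  dual_le (spread c) K.
Proof.
  intros Hc x Hx; destruct (S2_carrier_norm x Hx) as [Hx0 HxN].
  set (N := nrm S2 x) in *.
  assert (Hb : forall n, lsum (fun j => Cmod (x j * spread c j)%C) (seq 0 n)
                 <= K * N).
  { intro n.
    apply Rle_trans with
      (lsum (fun j => Cmod (x j * spread c j)%C) (seq 0 (2 ^ n - 1))).
    - apply lsum_seq_mono; [intro; apply Cmod_ge_0|].
      assert (n < 2 ^ n)%nat by (apply Nat.pow_gt_lin_r; lia); lia.
    - rewrite lsum_blocks.
      apply Rle_trans with (lsum (fun k => N * Cmod (c k)) (seq 0 n)).
      + apply lsum_le; intros k _.
        rewrite (lsum_ext _ (fun j => Cmod (c k) * / sqrt (2 ^ k) * Cmod (x j))).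
        * rewrite lsum_scal, Rmult_assoc, Rmult_comm.
          apply Rmult_le_compat_r; [apply Cmod_ge_0|].
          apply block_lsum_le; assumption.
        * intros j Hj; unfold spread; rewrite (in_block j k Hj).
          rewrite !Cmod_mult, Cmod_R, Rabs_pos_eq
            by (apply Rlt_le, Rinv_0_lt_compat, sqrt_pow2_pos).
          ring.
      + rewrite lsum_scal, Rmult_comm; apply Rmult_le_compat_r; auto. }
  destruct (ex_series_bounded _ _ (fun j => Cmod_ge_0 _) Hb) as [Hex _].
  destruct (ex_series_le (K := C_AbsRing) (V := C_CompleteNormedModule)
              (fun j => x j * spread c j)%C _ (fun j => Rle_refl _) Hex) as [l Hl].
  exists l; split; [exact Hl|].
  apply (is_series_C_bound _ l (K * N) Hl); intro n.
  eapply Rle_trans; [apply csum_Cmod|apply Hb].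
Qed.

(** * Transfer between the couples (S^2, its dual) and (c_0, l_1) *)

Lemma filterlim_strip f z :
  filterlim f (within strip (locally z)) (locally (f z)) <->
  continuous_on_strip_at f z.
Proof.
  split.
  - intros H e He.
    apply (proj1 (filterlim_locally_ball_norm (K := C_AbsRing)
             (U := C_NormedModule) _ _)) with (eps := mkposreal e He) in H.
    destruct (locally_norm_le_locally (K := C_AbsRing) (V := C_NormedModule)
                z _ H) as [d Hd]; exists d; split; [apply cond_pos|].
    intros w Hw Hwd; exact (Hd w Hwd Hw).
  - intro H; apply (proj2 (filterlim_locally_ball_norm (K := C_AbsRing)
             (U := C_NormedModule) _ _)); intro e.
    destruct (H e (cond_pos e)) as (d & Hd & Hw).
    apply (locally_le_locally_norm (K := C_AbsRing) (V := C_NormedModule) z).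
    exists (mkposreal d Hd); intros w Hwd Hws; exact (Hw w Hws Hwd).
Qed.

Lemma holo_strip_coordinate X Y F j : Finfty X Y F -> holo_strip (fun z => F z j).
Proof.
  intros (Hb & Hc & Ha & _); split; [apply Hb|split].
  - intros z Hz; apply (proj1 (filterlim_strip _ z)), Hc, Hz.
  - intros n z Hz; apply (analytic_jet n (fun w => F w j)), Ha, Hz.
Qed.

Lemma Finfty_norm_bounds F : Finfty S2 (dual S2) F ->
  forall t, nrm S2 (F (0, t)) <= Finfty_norm S2 (dual S2) F /\
            nrm (dual S2) (F (1, t)) <= Finfty_norm S2 (dual S2) F.
Proof.
  intros (_ & _ & _ & (_ & [M0 HM0] & _) & (_ & [M1 HM1] & _)) t.
  unfold Finfty_norm; split.
  - eapply Rle_trans; [|apply Rmax_l].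
    apply (fun H H' => proj2 (proj2 (real_Lub_Rbar
             (fun r => exists t, r = nrm S2 (F (0, t))) M0 H H'))).
    + intros r [s ->]; apply HM0.
    + exists (nrm S2 (F (0, 0))), 0; reflexivity.
    + exists t; reflexivity.
  - eapply Rle_trans; [|apply Rmax_r].
    apply (fun H H' => proj2 (proj2 (real_Lub_Rbar
             (fun r => exists t, r = nrm (dual S2) (F (1, t))) M1 H H'))).
    + intros r [s ->]; apply HM1.
    + exists (nrm (dual S2) (F (1, 0))), 0; reflexivity.
    + exists t; reflexivity.
Qed.

Lemma finitely_supported_pairing x y n :
  (forall j, (n <= j)%nat -> x j = RtoC 0) ->
  pairing x y (csum (fun j => x j * y j)%C (seq 0 n)).
Proof.
  intro Hx; apply is_series_C; intros e He; exists n; intros m Hm.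
  replace m with (n + (m - n))%nat by lia; rewrite seq_app, csum_app.
  rewrite (csum_ext _ (fun _ => RtoC 0) (seq (0 + n) (m - n))).
  - rewrite csum_const.
    match goal with |- Cmod ?w < e => replace w with (RtoC 0) by ring end.
    apply Cmod_0_lt, He.
  - intros j Hj; apply in_seq in Hj; rewrite Hx by lia; ring.
Qed.

Definition conj_phase (z : C) : C := (Cconj z * RtoC (/ Cmod z))%C.

Lemma conj_phase_mult z : (conj_phase z * z)%C = RtoC (Cmod z).
Proof.
  unfold conj_phase; destruct (Req_dec (Cmod z) 0) as [E|E].
  - rewrite E; apply Cmod_eq_0 in E; rewrite E; ring.
  - transitivity (RtoC (/ Cmod z) * (z * Cconj z))%C; [ring|].
    rewrite <- Cmod2_conj, <- RtoC_mult; f_equal; field; exact E.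
Qed.

Lemma Cmod_conj_phase_le z : Cmod (conj_phase z) <= 1.
Proof.
  unfold conj_phase; rewrite Cmod_mult, Cmod_conj.
  destruct (Req_dec (Cmod z) 0) as [E|E]; [rewrite E; lra|].
  assert (A := Cmod_ge_0 z).
  rewrite Cmod_R, Rabs_pos_eq by (apply Rlt_le, Rinv_0_lt_compat; lra).
  right; field; exact E.
Qed.

(** The functional [y] is tested on the block-constant sequence whose signs make
    the averages positive, bounded in S^2 by [S2_le_spread]. *)
Lemma average_dual_bound y n : carrier (dual S2) y ->
  lsum (fun k => Cmod (average y k)) (seq 0 n) <= 2 * nrm (dual S2) y.
Proof.
  intro Hy; destruct (dual_carrier_le y Hy) as (K & HK & HyK).
  destruct (dual_nrm_bounds y K HyK HK) as [_ Hb].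
  set (c := fun k => if (k <? n)%nat
                     then (RtoC (1 / 2) * conj_phase (average y k))%C else RtoC 0).
  assert (Hc : c00 c).
  { exists n; intros k Hk; unfold c.
    rewrite (proj2 (Nat.ltb_ge k n) Hk); reflexivity. }
  assert (Hc1 : forall k, Cmod (c k) <= 1 / 2).
  { intro k; unfold c; destruct (k <? n)%nat; [|rewrite Cmod_0; lra].
    rewrite Cmod_mult, Cmod_R, Rabs_pos_eq by lra.
    assert (A := Cmod_conj_phase_le (average y k)); lra. }
  assert (Hle : nrm S2 (spread c) <= 1).
  { apply S2_nrm_le; [lra|].
    replace 1 with (2 * (1 / 2)) by field; apply S2_le_spread, Hc1. }
  assert (Hp : pairing (spread c) y
            (csum (fun j => spread c j * y j)%C (seq 0 (2 ^ n - 1)))).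
  { apply finitely_supported_pairing; intros j Hj; unfold spread, c.
    assert (Hn : (n <= block_of j)%nat).
    { unfold block_of; rewrite <- (Nat.log2_pow2 n) by lia.
      apply Nat.log2_le_mono; lia. }
    rewrite (proj2 (Nat.ltb_ge _ n) Hn); ring. }
  assert (H := Hb _ _ (c00_carrier _ (spread_c00 c Hc)) Hle Hp).
  rewrite csum_blocks in H.
  rewrite (csum_ext _ (fun k => RtoC (1 / 2 * Cmod (average y k)))) in H.
  - rewrite csum_RtoC, lsum_scal, Cmod_R, Rabs_pos_eq in H; [lra|].
    apply Rmult_le_pos; [lra|apply lsum_nonneg; intros; apply Cmod_ge_0].
  - intros k Hk; apply in_seq in Hk.
    rewrite csum_spread_block; unfold c.
    rewrite (proj2 (Nat.ltb_lt k n)) by lia.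
    rewrite <- Cmult_assoc, conj_phase_mult, RtoC_mult; reflexivity.
Qed.

Lemma average_bounded F : Finfty S2 (dual S2) F ->
  c0_l1_bounded (2 * Finfty_norm S2 (dual S2) F) (fun k z => average (F z) k).
Proof.
  intro HF; assert (Hn := Finfty_norm_bounds F HF).
  assert (HF' := HF); destruct HF' as (_ & _ & _ & (H0 & _) & (H1 & _)).
  split; [|split].
  - intro k; apply holo_strip_scal, holo_strip_csum.
    intros j _; apply (holo_strip_coordinate _ _ F j HF).
  - intros k t; destruct (S2_carrier_norm _ (H0 t)) as [P Q].
    destruct (Hn t) as [Ht _].
    eapply Rle_trans; [apply Cmod_average_le|].
    eapply Rle_trans; [apply (block_lsum_le _ _ k P Q)|]; lra.
  - intros t n; destruct (Hn t) as [_ Ht].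
    eapply Rle_trans; [apply average_dual_bound, H1|]; lra.
Qed.

Lemma is_derive_average F (p : omega) k :
  (forall j, is_derive (K := C_AbsRing) (V := C_NormedModule)
               (fun z => F z j) half (p j)) ->
  is_derive (K := C_AbsRing) (V := C_NormedModule)
    (fun z => average (F z) k) half (average p k).
Proof.
  intro H; apply is_derive_C_scal.
  induction (block k) as [|j l IH].
  - apply (is_derive_const (K := C_AbsRing) (V := C_NormedModule) (RtoC 0)).
  - apply (is_derive_plus (K := C_AbsRing) (V := C_NormedModule)
             (fun z => F z j) (fun z => csum (F z) l)); [apply H|exact IH].
Qed.

Lemma uniform_boundary_continuity (c : nat -> C -> C) (a t : R) n e :
  0 <= a <= 1 -> (forall k, holo_strip (c k)) -> 0 < e ->
  exists d, 0 < d /\ forall s k, Rabs (s - t) < d -> (k < n)%nat ->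
    Cmod (c k (a, s) - c k (a, t))%C <= e.
Proof.
  intros Ha Hc He; induction n as [|n (d & Hd & IH)].
  - exists 1; split; [lra|intros; lia].
  - destruct (proj1 (proj2 (Hc n)) (a, t) Ha e He) as (d' & Hd' & Hn).
    exists (Rmin d d'); split; [apply Rmin_glb_lt; assumption|].
    intros s k Hs Hk.
    assert (A := Rmin_l d d'); assert (B := Rmin_r d d').
    destruct (Nat.eq_dec k n) as [->|].
    + apply Rlt_le, (Hn (a, s) Ha).
      replace ((a, s) - (a, t))%C with (Ci * RtoC (s - t))%C
        by (unfold Cminus, Cplus, Copp, Cmult, Ci, RtoC; simpl; f_equal; ring).
      rewrite Cmod_mult, Cmod_Ci, Cmod_R; lra.
    + apply IH; [lra|lia].
Qed.

Lemma filterlim_locally_0 (f : R -> R) t :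
  (forall s, 0 <= f s) ->
  (forall e, 0 < e -> exists d, 0 < d /\ forall s, Rabs (s - t) < d -> f s < e) ->
  filterlim f (locally t) (locally 0).
Proof.
  intros H0 H; apply filterlim_locally; intro e.
  destruct (H e (cond_pos e)) as (d & Hd & Hs).
  exists (mkposreal d Hd); intros s Hst.
  change (Rabs (f s - 0) < e); rewrite Rminus_0_r, Rabs_pos_eq by apply H0.
  apply Hs, Hst.
Qed.

(** Norm continuity: up to a small error that the domination controls, only
    finitely many coordinates matter, and these are continuous. *)
Lemma spread_Finfty M c : c0_l1_dominated M c ->
  Finfty S2 (dual S2) (fun z => spread (fun k => c k z)) /\
  Finfty_norm S2 (dual S2) (fun z => spread (fun k => c k z)) <= 2 * M.
Proof.
  intros (Hh & Ha & A & d & HA & HAM & HA0 & Hd & HdM).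
  assert (HA' : forall k, 0 <= A k)
    by (intro k; eapply Rle_trans; [apply Cmod_ge_0|apply (HA k 0)]).
  assert (Hd' : forall k, 0 <= d k)
    by (intro k; eapply Rle_trans; [apply Cmod_ge_0|apply (Hd k 0)]).
  assert (HM : 0 <= M) by (eapply Rle_trans; [apply (HA' 0%nat)|apply HAM]).
  assert (Hdiff : forall z w : C, Cmod (z - w)%C <= Cmod z + Cmod w).
  { intros z w; rewrite <- (Cmod_opp w); apply Cmod_triangle. }
  assert (Hcoord : forall j, holo_strip (fun z => spread (fun k => c k z) j)).
  { intro j; apply holo_strip_scal, Hh. }
  assert (HS2 : forall t, carrier S2 (spread (fun k => c k (0, t))) /\
                  nrm S2 (spread (fun k => c k (0, t))) <= 2 * M).
  { intro t; split.
    - apply spread_carrier; intros e He; destruct (HA0 e He) as [N HN].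
      exists N; intros k Hk; eapply Rle_lt_trans; [apply HA|apply HN, Hk].
    - apply S2_nrm_le; [lra|]; apply S2_le_spread.
      intro k; eapply Rle_trans; [apply HA|apply HAM]. }
  assert (Hdual : forall t n, lsum (fun k => Cmod (c k (1, t))) (seq 0 n) <= M).
  { intros t n; eapply Rle_trans; [|apply (HdM n)].
    apply lsum_le; intros; apply Hd. }
  assert (Hdual' : forall t, nrm (dual S2) (spread (fun k => c k (1, t))) <= 2 * M).
  { intro t; eapply Rle_trans;
      [apply (dual_nrm_bounds _ M (dual_le_spread _ M (Hdual t)) HM)|lra]. }
  split; [split; [|split; [|split; [|split]]]|].
  - intro j; apply Hcoord.
  - intros j z Hz; apply (proj2 (filterlim_strip
      (fun z => spread (fun k => c k z) j) z)).
    exact (proj1 (proj2 (Hcoord j)) z Hz).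
  - intros j z _; apply analytic_at_scal, Ha.
  - split; [intro; apply HS2|split; [exists (2 * M); intro; apply HS2|]].
    intro t.
    assert (Hclose : forall e, 0 < e -> exists delta, 0 < delta /\ forall s,
      Rabs (s - t) < delta ->
      forall k, Cmod (c k (0, s) - c k (0, t))%C <= e / 4).
    { intros e He; destruct (HA0 (e / 8)) as [N HN]; [lra|].
      destruct (uniform_boundary_continuity c 0 t N (e / 4))
        as (delta & Hdelta & Hc); [lra|exact Hh|lra|].
      exists delta; split; [exact Hdelta|]; intros s Hs k.
      destruct (Nat.lt_ge_cases k N); [apply Hc; assumption|].
      eapply Rle_trans; [apply Hdiff|].
      assert (B1 := HA k s); assert (B2 := HA k t).
      specialize (HN k ltac:(assumption)); lra. }
    apply filterlim_locally_0.
    + intro s; rewrite spread_minus.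
      apply (S2_nrm_le _ (2 * (2 * M))); [lra|]; apply S2_le_spread; intro k.
      eapply Rle_trans; [apply Hdiff|].
      assert (B1 := HA k s); assert (B2 := HA k t); assert (B3 := HAM k); lra.
    + intros e He; destruct (Hclose e He) as (delta & Hdelta & Hc).
      exists delta; split; [exact Hdelta|]; intros s Hs; rewrite spread_minus.
      apply Rle_lt_trans with (2 * (e / 4)); [|lra].
      apply S2_nrm_le; [lra|]; apply S2_le_spread, Hc, Hs.
  - split; [intro t; exists M; apply dual_le_spread, Hdual|split;
            [exists (2 * M); apply Hdual'|]].
    intro t.
    destruct (ex_series_bounded d M Hd' HdM) as [Hex _].
    assert (Hclose : forall e, 0 < e -> exists delta, 0 < delta /\ forall s,
      Rabs (s - t) < delta -> forall n,
      lsum (fun k => Cmod (c k (1, s) - c k (1, t))%C) (seq 0 n) <= e / 2).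
    { intros e He.
      assert (Hser := Series_correct _ Hex).
      apply is_series_lsum, is_lim_seq_spec in Hser.
      assert (He8 : 0 < e / 8) by lra.
      destruct (Hser (mkposreal _ He8)) as [N HN]; simpl in HN.
      assert (HeN : 0 < e / (4 * (INR N + 1))).
      { assert (B := pos_INR N); apply Rdiv_lt_0_compat; lra. }
      destruct (uniform_boundary_continuity c 1 t N _ ltac:(lra) Hh HeN)
        as (delta & Hdelta & Hc).
      exists delta; split; [exact Hdelta|]; intros s Hs n.
      apply Rle_trans with
        (lsum (fun k => Cmod (c k (1, s) - c k (1, t))%C) (seq 0 (N + n))).
      { apply lsum_seq_mono; [intro; apply Cmod_ge_0|lia]. }
      rewrite seq_app, lsum_app.
      assert (B1 : lsum (fun k => Cmod (c k (1, s) - c k (1, t))%C) (seq 0 N)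
                   <= e / 4).
      { eapply Rle_trans;
          [apply (lsum_le _ (fun _ => e / (4 * (INR N + 1))))|].
        - intros k Hk; apply in_seq in Hk; apply Hc; [assumption|lia].
        - rewrite lsum_const, length_seq; assert (B := pos_INR N).
          apply Rle_trans with ((INR N + 1) * (e / (4 * (INR N + 1)))).
          + apply Rmult_le_compat_r; lra.
          + right; field; lra. }
      assert (B2 : lsum (fun k => Cmod (c k (1, s) - c k (1, t))%C) (seq (0 + N) n)
                   <= e / 4).
      { eapply Rle_trans; [apply (lsum_le _ (fun k => 2 * d k))|].
        - intros k _; eapply Rle_trans; [apply Hdiff|].
          assert (C1 := Hd k s); assert (C2 := Hd k t); lra.
        - rewrite lsum_scal.
          assert (C1 := lsum_le_Series d (N + n) Hd' Hex).
          rewrite seq_app, lsum_app in C1.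
          assert (C2 := HN N (le_n N)); apply Rabs_def2 in C2; lra. }
      lra. }
    apply filterlim_locally_0.
    + intro s; rewrite spread_minus.
      apply (dual_nrm_bounds _ (2 * M)); [|lra]; apply dual_le_spread; intro n.
      eapply Rle_trans; [apply lsum_le; intros; apply Hdiff|].
      rewrite lsum_plus.
      assert (B1 := Hdual s n); assert (B2 := Hdual t n); lra.
    + intros e He; destruct (Hclose e He) as (delta & Hdelta & Hc).
      exists delta; split; [exact Hdelta|]; intros s Hs; rewrite spread_minus.
      apply Rle_lt_trans with (e / 2); [|lra].
      apply dual_nrm_bounds; [|lra]; apply dual_le_spread, Hc, Hs.
  - apply Rmax_lub.
    + apply (real_Lub_Rbar (fun r => exists t, r =
        nrm S2 (spread (fun k => c k (0, t))))).
      * intros r [t ->]; apply HS2.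
      * eexists; exists 0; reflexivity.
    + apply (real_Lub_Rbar (fun r => exists t, r =
        nrm (dual S2) (spread (fun k => c k (1, t))))).
      * intros r [t ->]; apply Hdual'.
      * eexists; exists 0; reflexivity.
Qed.

(** * The embedding *)

(** The factor [2] comes from the exponent [2 z] of the extremal functions of
    the couple [(c_0, l_1)]. *)
Definition embed (p : omega2) : omega2 :=
  (spread (fun k => RtoC 2 * fst p k)%C, spread (snd p)).

Definition unembed (w : omega2) : omega2 :=
  (fun k => RtoC (1 / 2) * average (fst w) k, average (snd w))%C.

Lemma unembed_embed p : unembed (embed p) = p.
Proof.
  destruct p as [x y]; unfold unembed, embed; simpl; rewrite !average_spread.
  apply (f_equal (fun z : omega => (z, y))).
  apply functional_extensionality; intro k.
  rewrite Cmult_assoc, <- RtoC_mult.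
  replace (1 / 2 * 2) with 1 by field; apply Cmult_1_l.
Qed.

Lemma embed_linear (a : C) (p q : omega2) :
  embed (plus (scal a p) q) = plus (scal a (embed p)) (embed q).
Proof.
  destruct p as [x y], q as [x' y'].
  apply injective_projections; apply functional_extensionality; intro j;
    set (m := block_of j); set (r := RtoC (/ sqrt (2 ^ m))).
  - change (r * (RtoC 2 * (a * x m + x' m))
      = a * (r * (RtoC 2 * x m)) + r * (RtoC 2 * x' m))%C; ring.
  - change (r * (a * y m + y' m) = a * (r * y m) + r * y' m)%C; ring.
Qed.

Lemma embed_minus (p q : omega2) : minus (embed p) (embed q) = embed (minus p q).
Proof.
  destruct p as [x y], q as [x' y'].
  apply injective_projections; apply functional_extensionality; intro j;
    set (m := block_of j); set (r := RtoC (/ sqrt (2 ^ m))).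
  - change (r * (RtoC 2 * x m) + - (r * (RtoC 2 * x' m))
      = r * (RtoC 2 * (x m + - x' m)))%C; ring.
  - change (r * y m + - (r * y' m) = r * (y m + - y' m))%C; ring.
Qed.

(** The quasi-linearity of [Omega] comes out of the interpolation: extensions of
    two pairs subtract to one of the difference, and an extension decides
    membership in [Z2]. *)
Lemma Z2_minus (p q : omega2) : carrier Z2 p -> carrier Z2 q ->
  carrier Z2 (minus p q).
Proof.
  destruct p as [x y], q as [x' y']; intros Hp Hq.
  destruct (Z2_extension x y Hp) as (c & Hc & Hc1 & Hc2).
  destruct (Z2_extension x' y' Hq) as (c' & Hc' & Hc1' & Hc2').
  change (carrier Z2 ((fun k => x k - x' k)%C, (fun k => y k - y' k)%C)).
  refine (proj1 (half_derivative_bound _ _ _ _ (c0_l1_bounded_minus _ _ c c'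
            (c0_l1_dominated_bounded _ _ Hc) (c0_l1_dominated_bounded _ _ Hc'))
            _ _)).
  - intro k; cbv beta; rewrite Hc1, Hc1'; reflexivity.
  - intro k.
    assert (H := is_derive_minus (K := C_AbsRing) (V := C_NormedModule)
                   _ _ half _ _ (Hc2 k) (Hc2' k)).
    replace (RtoC 2 * (x k - x' k))%C with (RtoC 2 * x k - RtoC 2 * x' k)%C
      by ring.
    exact H.
Qed.

Definition represents (F : C -> omega) (p : omega2) : Prop :=
  Finfty S2 (dual S2) F /\ F half = snd p /\
  forall j, is_derive (K := C_AbsRing) (V := C_NormedModule)
              (fun z => F z j) half (fst p j).

Lemma Finfty_norm_nonneg F : Finfty S2 (dual S2) F ->
  0 <= Finfty_norm S2 (dual S2) F.
Proof.
  intro HF; eapply Rle_trans; [|exact (proj1 (Finfty_norm_bounds F HF 0))].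
  apply S2_carrier_norm; apply HF.
Qed.

Lemma derived_norm_spec p F : represents F p ->
  is_finite (derived_norm S2 p) /\
  0 <= real (derived_norm S2 p) <= Finfty_norm S2 (dual S2) F /\
  forall e, real (derived_norm S2 p) < e ->
    exists G, represents G p /\ Finfty_norm S2 (dual S2) G < e.
Proof.
  intros (HF1 & HF2 & HF3); unfold derived_norm.
  set (E := fun r => exists F : C -> omega, _).
  assert (HE : E (Finfty_norm S2 (dual S2) F)) by (exists F; auto).
  assert (HE0 : forall r, E r -> 0 <= r).
  { intros r (G & HG & _ & _ & ->); apply Finfty_norm_nonneg, HG. }
  destruct (Glb_Rbar_correct E) as [Hlb Hglb].
  assert (H0 : Rbar_le 0 (Glb_Rbar E)) by (apply Hglb; intros r Hr; apply HE0, Hr).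
  assert (H1 := Hlb _ HE).
  destruct (Glb_Rbar E) as [g| |]; [|destruct H1|destruct H0].
  split; [reflexivity|split; [split; [exact H0|exact H1]|]].
  intros e He; simpl in He; apply NNPP; intro Hno.
  assert (Hge : Rbar_le e g).
  { apply Hglb; intros r (G & HG1 & HG2 & HG3 & ->); apply Rnot_lt_le; intro Hlt.
    apply Hno; exists G; split; [split; [|split]|]; assumption. }
  simpl in Hge; lra.
Qed.

Lemma embed_represented p : carrier Z2 p -> exists F, represents F (embed p) /\
  Finfty_norm S2 (dual S2) F <= 104 * nrm Z2 p.
Proof.
  destruct p as [x y]; intro Hp.
  destruct (Z2_extension x y Hp) as (c & Hc & Hc1 & Hc2).
  destruct (spread_Finfty _ _ Hc) as [HF HFn].
  exists (fun z => spread (fun k => c k z)); split; [split; [exact HF|split]|].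
  - simpl; f_equal; apply functional_extensionality, Hc1.
  - intro j; apply is_derive_C_scal, Hc2.
  - replace 104 with (2 * 52) by ring; rewrite Rmult_assoc; exact HFn.
Qed.

Lemma represented_bound F p : represents F (embed p) ->
  nrm Z2 p <= 6 * Finfty_norm S2 (dual S2) F.
Proof.
  destruct p as [x y]; intros (HF & HF1 & HF2).
  replace (6 * Finfty_norm S2 (dual S2) F)
    with (3 * (2 * Finfty_norm S2 (dual S2) F)) by ring.
  apply (half_derivative_bound _ (fun k z => average (F z) k) x y
           (average_bounded F HF)).
  - intro k; rewrite HF1; simpl; rewrite average_spread; reflexivity.
  - intro k; assert (H := is_derive_average F _ k HF2); simpl in H.
    rewrite average_spread in H; exact H.
Qed.

Lemma embed_norm p : carrier Z2 p ->
  carrier (derived S2) (embed p) /\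
  nrm (derived S2) (embed p) <= 104 * nrm Z2 p /\
  forall e, nrm (derived S2) (embed p) < e -> nrm Z2 p < 6 * e.
Proof.
  intro Hp; destruct (embed_represented p Hp) as (F & HF & HFn).
  destruct (derived_norm_spec _ _ HF) as (Hfin & [_ Hle] & Hinf).
  split; [exact Hfin|split; [eapply Rle_trans; [exact Hle|exact HFn]|]].
  intros e He; destruct (Hinf e He) as (G & HG & HGn).
  assert (H := represented_bound G p HG); lra.
Qed.

Theorem lemma1 : contains_copy (derived S2) Z2.
Proof.
  exists (fun w => exists p, carrier Z2 p /\ w = embed p); split.
  { intros w (p & Hp & ->); apply embed_norm, Hp. }
  exists embed, unembed.
  split; [|split; [|split; [|split]]].
  - intros a p q _ _; apply embed_linear.
  - intros p Hp; split; [exists p; auto|apply unembed_embed].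
  - intros w (p & Hp & ->); rewrite unembed_embed; auto.
  - intros p Hp e He; exists (e / 104); split; [lra|].
    intros q Hq Hlt; rewrite embed_minus.
    destruct (embed_norm _ (Z2_minus q p Hq Hp)) as (_ & Hle & _).
    eapply Rle_lt_trans; [exact Hle|lra].
  - intros w (p & Hp & ->) e He; exists (e / 6); split; [lra|].
    intros w' (q & Hq & ->) Hlt; rewrite !unembed_embed.
    rewrite embed_minus in Hlt.
    replace e with (6 * (e / 6)) by field.
    apply (embed_norm _ (Z2_minus q p Hq Hp)), Hlt.
Qed.
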